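(* Let $K_1$ and $K_2$ be two finite Galois extensions of $\mathbb{Q}$. Let $K_0=K_1\cap K_2$ and $L=K_1K_2$. If the degrees $[K_1:K_0]$, $[K_2:K_0]$ and $[K_0:\mathbb{Q}]$ are pairwise relatively prime, then $$\mathcal{P}o(L)\simeq \mathcal{P}o(K_0)\oplus\left(\mathcal{P}o(K_1)/\varepsilon_{K_0}^{K_1}(\mathcal{P}o(K_0))\right)\oplus\left(\mathcal{P}o(K_2)/\varepsilon_{K_0}^{K_2}(\mathcal{P}o(K_0))\right).$$
   Context: For a number field $K$ with ring of integers $\mathcal{O}_K$ and class group $\mathcal{C}l(K)$, and for each positive integer $q$, $\Pi_q(K)$ denotes the product of all maximal ideals of $\mathcal{O}_K$ of norm $q$ (with $\Pi_q(K)=\mathcal{O}_K$ if there is none). The Pólya group $\mathcal{P}o(K)$ is the subgroup of $\mathcal{C}l(K)$ generated by the classes of all the ideals $\Pi_q(K)$, $q\ge 1$. For a finite extension $L/K$ of number fields, $\varepsilon_K^L:\mathcal{C}l(K)\to\mathcal{C}l(L)$ is the homomorphism sending the class of an ideal $I$ to the class of $I\mathcal{O}_L$; when $K$ and $L$ are both Galois over $\mathbb{Q}$ it maps $\mathcal{P}o(K)$ into $\mathcal{P}o(L)$. *)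

(* Defs.v *)
From HB Require Import structures.
From mathcomp Require Import all_boot all_order all_algebra all_field.
From mathcomp Require Import all_classical.

Set Implicit Arguments.
Unset Strict Implicit.
Unset Printing Implicit Defensive.

Import GRing.Theory.

Local Open Scope classical_set_scope.
Local Open Scope card_scope.
Local Open Scope quotient_scope.
Local Open Scope ring_scope.

Section GeneratedSubgroup.
Variables (V : zmodType) (S : set V).

Definition gen_subgroup : {pred V} :=
  fun v => `[< forall H : zmodClosed V, (forall s, S s -> s \in H) -> v \in H >].

Fact gen_subgroup_closed : zmod_closed gen_subgroup.
Proof.
split=> [|u v /asboolP Hu /asboolP Hv].
  by apply/asboolP=> H _; exact: rpred0.
by apply/asboolP=> H SH; apply: rpredB; [exact: Hu|exact: Hv].
Qed.

HB.instance Definition _ :=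
  GRing.isZmodClosed.Build V gen_subgroup gen_subgroup_closed.

End GeneratedSubgroup.

(* Number fields are the subfields K of a fixed finite extension M of the     *)
(* rationals; ideals and fractional ideals of K are subsets of M.             *)
Section Ideals.
Variables (M : fieldExtType rat) (K : {subfield M}).

Definition ring_of_integers : set M :=
  [set x | x \in K /\ integralOver (intr : int -> M) x].
Local Notation OK := ring_of_integers.

Definition integer_submodule (I : set M) : Prop :=
  [/\ I 0, forall x y, I x -> I y -> I (x + y)
    & forall a x, OK a -> I x -> I (a * x)].

Definition integral_ideal (I : set M) : Prop :=
  I `<=` OK /\ integer_submodule I.

Definition fractional_ideal (I : set M) : Prop :=
  [/\ I `<=` [set` K], integer_submodule I
    & exists d, [/\ OK d, d != 0 & forall x, I x -> OK (d * x)]].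

Definition maximal_ideal (P : set M) : Prop :=
  [/\ integral_ideal P, P <> OK
    & forall J, integral_ideal J -> P `<=` J -> J = P \/ J = OK].

Definition has_norm (I : set M) (q : nat) : Prop :=
  [set [set x + y | y in I] | x in OK] #= `I_q.

Definition ideal_mul (I J : set M) : set M :=
  [set x | exists s : seq (M * M),
     (forall p, p \in s -> I p.1 /\ J p.2) /\ x = \sum_(p <- s) p.1 * p.2].

(* The set of maximal ideals of a given norm is always finite, so the default *)
(* value of the finitely supported product is never used.                     *)
Definition Pi_ideal (q : nat) : set M :=
  \big[ideal_mul / OK]_(P \in [set P | maximal_ideal P /\ has_norm P q]) P.

Definition invertible_ideal (I : set M) : Prop :=
  fractional_ideal I /\ exists2 J, fractional_ideal J & ideal_mul I J = OK.

Definition principal_ideal (a : M) : set M := [set a * x | x in OK].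

End Ideals.

Section IdealTheory.
Variable (M : fieldExtType rat).
Implicit Types (K E : {subfield M}) (I J : set M) (a : M).
Local Notation O := (@ring_of_integers M).

Lemma ring_of_integersB K x y : O K x -> O K y -> O K (x - y).
Proof.
by move=> [Kx ix] [Ky iy]; split; [exact: rpredB|exact: integral_sub].
Qed.

Lemma ring_of_integersM K x y : O K x -> O K y -> O K (x * y).
Proof.
by move=> [Kx ix] [Ky iy]; split; [exact: rpredM|exact: integral_mul].
Qed.

Lemma ring_of_integers1 K : O K 1.
Proof. by split; [exact: rpred1|exact: integral1]. Qed.

Lemma ring_of_integers0 K : O K 0.
Proof. by split; [exact: rpred0|exact: integral0]. Qed.

Lemma ring_of_integersN K x : O K x -> O K (- x).
Proof.
by move=> Ox; rewrite -sub0r; apply: ring_of_integersB=> //;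
  exact: ring_of_integers0.
Qed.

Lemma ring_of_integersD K x y : O K x -> O K y -> O K (x + y).
Proof.
by move=> Ox Oy; rewrite -[y]opprK; apply: ring_of_integersB=> //;
  exact: ring_of_integersN.
Qed.

Lemma ring_of_integersS K E : (K <= E)%VS -> O K `<=` O E.
Proof. by move=> /subvP KE x [Kx ix]; split=> //; exact: KE. Qed.

Lemma integer_submodule_O K : integer_submodule K (O K).
Proof.
split; [exact: ring_of_integers0|exact: ring_of_integersD|].
exact: ring_of_integersM.
Qed.

Lemma fractional_ideal_O K : fractional_ideal K (O K).
Proof.
split; [by move=> x [] | exact: integer_submodule_O|].
exists 1; split; [exact: ring_of_integers1|exact: oner_neq0|].
by move=> x; rewrite mul1r.
Qed.

Lemma ideal_mul_incl I J x y : I x -> J y -> ideal_mul I J (x * y).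
Proof.
move=> Ix Jy; exists [:: (x, y)]; split; last by rewrite big_seq1.
by move=> p; rewrite inE => /eqP ->.
Qed.

Lemma ideal_mul0 I J : ideal_mul I J 0.
Proof. by exists [::]; split=> //; rewrite big_nil. Qed.

Lemma ideal_mulD I J x y :
  ideal_mul I J x -> ideal_mul I J y -> ideal_mul I J (x + y).
Proof.
move=> [s [sIJ ->]] [t [tIJ ->]]; exists (s ++ t); rewrite big_cat.
by split=> // p; rewrite mem_cat => /orP[/sIJ|/tIJ].
Qed.

Lemma ideal_mul_min I J (H : set M) :
    H 0 -> (forall x y, H x -> H y -> H (x + y)) ->
    (forall x y, I x -> J y -> H (x * y)) ->
  ideal_mul I J `<=` H.
Proof.
move=> H0 HD HM x [s [sIJ ->]]; elim: s sIJ => [|p s IHs] sIJ.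
  by rewrite big_nil.
rewrite big_cons; apply: HD.
  by have [Ip Jp] := sIJ p (mem_head _ _); exact: HM.
by apply: IHs => u us; apply: sIJ; rewrite inE us orbT.
Qed.

Lemma ideal_mulC : commutative (@ideal_mul M).
Proof.
move=> I J; rewrite eqEsubset; split; apply: ideal_mul_min;
  do ?[exact: ideal_mul0|exact: ideal_mulD] => x y Ix Jy;
  by rewrite mulrC; exact: ideal_mul_incl.
Qed.

Lemma ideal_mulA : associative (@ideal_mul M).
Proof.
have sub I J H : ideal_mul I (ideal_mul J H) `<=` ideal_mul (ideal_mul I J) H.
  apply: ideal_mul_min; do ?[exact: ideal_mul0|exact: ideal_mulD].
  move=> x y Ix; move: y; apply: ideal_mul_min.
  - by rewrite mulr0; exact: ideal_mul0.
  - by move=> y z; rewrite mulrDr; exact: ideal_mulD.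
  - move=> y z Jy Hz; rewrite mulrA; do 2?[apply: ideal_mul_incl=> //].
move=> I J H; rewrite eqEsubset; split; first exact: sub.
rewrite ideal_mulC [ideal_mul I J]ideal_mulC.
by rewrite [X in _ `<=` X]ideal_mulC [ideal_mul J H]ideal_mulC; exact: sub.
Qed.

Lemma ideal_mul1 K I : integer_submodule K I -> ideal_mul (O K) I = I.
Proof.
move=> [I0 ID IM]; rewrite eqEsubset; split; first exact: ideal_mul_min.
move=> x Ix; rewrite -[x]mul1r; apply: ideal_mul_incl=> //.
exact: ring_of_integers1.
Qed.

Lemma integer_submodule_mul K I J :
  integer_submodule K I -> integer_submodule K (ideal_mul I J).
Proof.
move=> [I0 ID IM]; split; [exact: ideal_mul0|exact: ideal_mulD|].
move=> a x Oa; move: x; apply: ideal_mul_min.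
- by rewrite mulr0; exact: ideal_mul0.
- by move=> y z; rewrite mulrDr; exact: ideal_mulD.
- by move=> x y Ix Jy; rewrite mulrA; apply: ideal_mul_incl=> //; exact: IM.
Qed.

Lemma fractional_ideal_mul K I J :
  fractional_ideal K I -> fractional_ideal K J ->
  fractional_ideal K (ideal_mul I J).
Proof.
move=> [IK subI [d [Od d0 dI]]] [JK subJ [e [Oe e0 eJ]]]; split.
- apply: ideal_mul_min => [|x y Kx Ky|x y Ix Jy]; rewrite /=.
  + exact: rpred0.
  + exact: rpredD.
  + by apply: rpredM; [exact: IK|exact: JK].
- exact: integer_submodule_mul.
exists (d * e); split; [exact: ring_of_integersM|by rewrite mulf_neq0|].
apply: ideal_mul_min => [|x y Kx Ky|x y Ix Jy].
- by rewrite mulr0; exact: ring_of_integers0.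
- by rewrite mulrDr; exact: ring_of_integersD.
- by rewrite mulrACA; apply: ring_of_integersM; [exact: dI|exact: eJ].
Qed.

Lemma invertible_ideal_mul K I J :
  invertible_ideal K I -> invertible_ideal K J ->
  invertible_ideal K (ideal_mul I J).
Proof.
move=> [fI [I' fI' II']] [fJ [J' fJ' JJ']]; split.
  exact: fractional_ideal_mul.
exists (ideal_mul I' J'); first exact: fractional_ideal_mul.
rewrite ideal_mulA [ideal_mul (ideal_mul I J) I']ideal_mulC.
rewrite ideal_mulA [ideal_mul I' I]ideal_mulC II' -ideal_mulA JJ' ideal_mul1//.
exact: integer_submodule_O.
Qed.

Lemma invertible_ideal_O K : invertible_ideal K (O K).
Proof.
split; [|exists (O K)]; do ?exact: fractional_ideal_O.
by rewrite ideal_mul1//; exact: integer_submodule_O.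
Qed.

Lemma integer_submodule_principal K a :
  integer_submodule K (principal_ideal K a).
Proof.
split=> [|_ _ [x Ox <-] [y Oy <-]|b _ Ob [x Ox <-]].
- by exists 0; rewrite ?mulr0//; exact: ring_of_integers0.
- by exists (x + y); rewrite ?mulrDr//; exact: ring_of_integersD.
- by exists (b * x); [exact: ring_of_integersM|rewrite mulrCA].
Qed.

Lemma principal_ideal_mul K a b :
  ideal_mul (principal_ideal K a) (principal_ideal K b) =
  principal_ideal K (a * b).
Proof.
have [H0 HD HM] := integer_submodule_principal K (a * b).
rewrite eqEsubset; split.
  apply: ideal_mul_min => // _ _ [x Ox <-] [y Oy <-].
  by exists (x * y); [exact: ring_of_integersM|rewrite mulrACA].
move=> _ [x Ox <-]; have -> : a * b * x = (a * 1) * (b * x).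
  by rewrite mulr1 mulrA.
apply: ideal_mul_incl; last by exists x.
by exists 1=> //; exact: ring_of_integers1.
Qed.

Lemma principal_ideal1 K : principal_ideal K 1 = O K.
Proof.
rewrite eqEsubset; split=> [_ [x Ox <-]|x Ox]; first by rewrite mul1r.
by exists x=> //; rewrite mul1r.
Qed.

Lemma ideal_mul_extD K E I J : (K <= E)%VS ->
  ideal_mul (ideal_mul I J) (O E) =
  ideal_mul (ideal_mul I (O E)) (ideal_mul J (O E)).
Proof.
move=> KE; rewrite -[in LHS](ideal_mul1 (integer_submodule_O E)).
rewrite -!ideal_mulA; congr (ideal_mul I _).
by rewrite !ideal_mulA [ideal_mul J _]ideal_mulC.
Qed.

Lemma ideal_mul_extO K E : (K <= E)%VS -> ideal_mul (O K) (O E) = O E.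
Proof.
move=> KE; have [H0 HD HM] := integer_submodule_O E.
rewrite eqEsubset; split.
  by apply: ideal_mul_min=> // x y /(ring_of_integersS KE); exact: HM.
move=> x Ox; rewrite -[x]mul1r; apply: ideal_mul_incl=> //.
exact: ring_of_integers1.
Qed.

Lemma fractional_ideal_ext K E I : (K <= E)%VS ->
  fractional_ideal K I -> fractional_ideal E (ideal_mul I (O E)).
Proof.
move=> KE [IK subI [d [Od d0 dI]]]; split.
- apply: ideal_mul_min => [|x y Kx Ky|x y Ix [Ey _]]; rewrite /=.
  + exact: rpred0.
  + exact: rpredD.
  + by apply: rpredM=> //; apply: (subvP KE); exact: IK.
- by rewrite ideal_mulC; apply: integer_submodule_mul; exact: integer_submodule_O.
exists d; split=> //; first exact: ring_of_integersS KE _ Od.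
apply: ideal_mul_min => [|x y Kx Ky|x y Ix Oy].
- by rewrite mulr0; exact: ring_of_integers0.
- by rewrite mulrDr; exact: ring_of_integersD.
- rewrite mulrA; apply: ring_of_integersM=> //.
  by apply: ring_of_integersS KE _ _; exact: dI.
Qed.

Lemma invertible_ideal_ext K E I : (K <= E)%VS ->
  invertible_ideal K I -> invertible_ideal E (ideal_mul I (O E)).
Proof.
move=> KE [fI [J fJ IJ]]; split; first exact: fractional_ideal_ext fI.
exists (ideal_mul J (O E)); first exact: fractional_ideal_ext fJ.
by rewrite -(ideal_mul_extD _ _ KE) IJ ideal_mul_extO.
Qed.

Lemma principal_ideal_ext K E a : (K <= E)%VS ->
  ideal_mul (principal_ideal K a) (O E) = principal_ideal E a.
Proof.
move=> KE; have [H0 HD HM] := integer_submodule_principal E a.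
rewrite eqEsubset; split.
  apply: ideal_mul_min=> // _ y [x Ox <-] Oy; exists (x * y).
    by apply: ring_of_integersM=> //; exact: ring_of_integersS KE _ Ox.
  by rewrite mulrA.
move=> _ [x Ox <-]; apply: ideal_mul_incl=> //.
by exists 1; [exact: ring_of_integers1|rewrite mulr1].
Qed.

End IdealTheory.

(* The group of invertible fractional ideals, i.e. of all nonzero fractional  *)
(* ideals since rings of integers are Dedekind. It is a zmodType: the         *)
(* operation + is multiplication of ideals and 0 is the ring of integers.     *)
Record idealGroup (M : fieldExtType rat) (K : {subfield M}) := IdealGroup {
  ideal_set :> set M;
  _ : `[< invertible_ideal K ideal_set >] }.

Section IdealGroup.
Variables (M : fieldExtType rat) (K : {subfield M}).
Local Notation OK := (ring_of_integers K).

HB.instance Definition _ := [isSub for @ideal_set M K].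
HB.instance Definition _ := [Choice of idealGroup K by <:].

Lemma idealGroupP (I : idealGroup K) : invertible_ideal K I.
Proof. by case: I => I /= /asboolP. Qed.

Definition ideal_group_one : idealGroup K :=
  IdealGroup (asboolT (invertible_ideal_O K)).

Definition ideal_group_mul (I J : idealGroup K) : idealGroup K :=
  IdealGroup (asboolT (invertible_ideal_mul (idealGroupP I) (idealGroupP J))).

Fact ideal_group_inv_subproof (I : idealGroup K) :
  exists J : idealGroup K, ideal_mul J I = OK.
Proof.
have [fI [J fJ IJ]] := idealGroupP I.
have iJ : invertible_ideal K J by split=> //; exists I=> //; rewrite ideal_mulC.
by exists (IdealGroup (asboolT iJ)); rewrite ideal_mulC.
Qed.

Definition ideal_group_inv (I : idealGroup K) : idealGroup K :=
  sval (cid (ideal_group_inv_subproof I)).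

Fact ideal_group_mulA : associative ideal_group_mul.
Proof. by move=> I J H; apply: val_inj; exact: ideal_mulA. Qed.

Fact ideal_group_mulC : commutative ideal_group_mul.
Proof. by move=> I J; apply: val_inj; exact: ideal_mulC. Qed.

Fact ideal_group_mul1 : left_id ideal_group_one ideal_group_mul.
Proof.
move=> I; apply: val_inj; apply: ideal_mul1.
by have [[]] := idealGroupP I.
Qed.

Fact ideal_group_mulV :
  left_inverse ideal_group_one ideal_group_inv ideal_group_mul.
Proof.
by move=> I; apply: val_inj; rewrite /= /ideal_group_inv; case: cid.
Qed.

HB.instance Definition _ := GRing.isZmodule.Build (idealGroup K)
  ideal_group_mulA ideal_group_mulC ideal_group_mul1 ideal_group_mulV.

Lemma ideal_group0E : ideal_set (0 : idealGroup K) = OK. Proof. by []. Qed.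

Lemma ideal_groupDE (I J : idealGroup K) :
  ideal_set (I + J) = ideal_mul I J.
Proof. by []. Qed.

Definition principal : {pred idealGroup K} := fun I =>
  `[< exists a, [/\ a \in K, a != 0 & ideal_set I = principal_ideal K a] >].

Fact principal_closed : zmod_closed principal.
Proof.
split=> [|I J /asboolP[a [Ka a0 Ia]] /asboolP[b [Kb b0 Jb]]]; apply/asboolP.
  exists 1; split; [exact: rpred1|exact: oner_neq0|].
  by rewrite principal_ideal1 ideal_group0E.
exists (a / b); split; [exact: rpred_div|by rewrite mulf_neq0 ?invr_eq0|].
have JE : ideal_mul (ideal_set J) (principal_ideal K b^-1) = OK.
  by rewrite Jb principal_ideal_mul mulfV// principal_ideal1.
rewrite -principal_ideal_mul -Ia ideal_groupDE; congr ideal_mul.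
have subJ : integer_submodule K (ideal_set (- J)).
  by have [[]] := idealGroupP (- J).
rewrite -(ideal_mul1 subJ) -JE -ideal_mulA.
rewrite [ideal_mul (principal_ideal K b^-1) _]ideal_mulC ideal_mulA.
rewrite -ideal_groupDE subrr ideal_group0E ideal_mul1//.
exact: integer_submodule_principal.
Qed.

HB.instance Definition _ :=
  GRing.isZmodClosed.Build (idealGroup K) principal principal_closed.

Definition classGroup : zmodType := Quotient.quot principal.

Definition ideal_class (I : idealGroup K) : classGroup := \pi_(Quotient.quot principal) I.

Definition polya : {pred classGroup} :=
  gen_subgroup [set c | exists2 q, (0 < q)%N &
    exists2 I : idealGroup K, ideal_set I = Pi_ideal K q & c = ideal_class I].

HB.instance Definition _ := GRing.ZmodClosed.on polya.

Definition polyaGroup := {c : classGroup | c \in polya}.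

HB.instance Definition _ := SubChoice.on polyaGroup.
HB.instance Definition _ :=
  [SubChoice_isSubZmodule of polyaGroup by <:].

End IdealGroup.

Arguments principal {M} K _.
Arguments polya {M} K _.

Section Extension.
Variables (M : fieldExtType rat) (K E : {subfield M}) (KE : (K <= E)%VS).

Definition ext_ideal (I : idealGroup K) : idealGroup E :=
  IdealGroup (asboolT (invertible_ideal_ext KE (idealGroupP I))).

Fact ext_ideal_is_zmod_morphism : zmod_morphism ext_ideal.
Proof.
have extD I J : ext_ideal (I + J) = ext_ideal I + ext_ideal J.
  by apply: val_inj; exact: (ideal_mul_extD _ _ KE).
by move=> I J; apply/eqP; rewrite eq_sym subr_eq -extD subrK.
Qed.

HB.instance Definition _ := GRing.isZmodMorphism.Build
  (idealGroup K) (idealGroup E) ext_ideal ext_ideal_is_zmod_morphism.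

Definition ext_class (c : classGroup K) : classGroup E :=
  ideal_class (ext_ideal (repr c)).

Lemma ext_classE (I : idealGroup K) :
  ext_class (ideal_class I) = ideal_class (ext_ideal I).
Proof.
apply/eqP; rewrite /ext_class /ideal_class -Quotient.idealrBE -raddfB.
have /asboolP[a [Ka a0 IE]] : repr (ideal_class I) - I \in principal K.
  by rewrite Quotient.idealrBE reprK.
apply/asboolP; exists a; split=> //; first exact: (subvP KE).
by rewrite -(principal_ideal_ext _ KE) -IE.
Qed.

Fact ext_class_is_zmod_morphism : zmod_morphism ext_class.
Proof.
move=> c d; rewrite -[c]reprK -[d]reprK.
have -> : \pi_(Quotient.quot (principal K)) (repr c) - \pi_(Quotient.quot (principal K)) (repr d) = ideal_class (repr c - repr d).
  by rewrite /ideal_class raddfB.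
by rewrite !ext_classE raddfB /ideal_class raddfB.
Qed.

HB.instance Definition _ := GRing.isZmodMorphism.Build
  (classGroup K) (classGroup E) ext_class ext_class_is_zmod_morphism.

(* The image of Po(K) under extension of ideals, as a subgroup of Po(E). This *)
(* is the whole image when K and E are Galois over the rationals, since it is *)
(* then contained in Po(E).                                                   *)
Definition ext_polya : {pred polyaGroup E} :=
  fun c => `[< exists2 d, d \in polya K & val c = ext_class d >].

Fact ext_polya_closed : zmod_closed ext_polya.
Proof.
split=> [|u v /asboolP[c Pc uE] /asboolP[d Pd vE]]; apply/asboolP.
  by exists 0; rewrite ?rpred0 ?raddf0.
by exists (c - d); rewrite ?rpredB// !raddfB /= uE vE.
Qed.

HB.instance Definition _ :=
  GRing.isZmodClosed.Build (polyaGroup E) ext_polya ext_polya_closed.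

Definition relPolyaGroup : zmodType := Quotient.quot ext_polya.

End Extension.

Definition zmod_isomorphic (U V : zmodType) : Prop :=
  exists f : {additive U -> V}, bijective f.

(* Main.v *)
Require Import Defs.
From HB Require Import structures.
From mathcomp Require Import all_boot all_order all_algebra all_fingroup.
From mathcomp Require Import all_field.
From mathcomp Require Import all_classical.
From mathcomp Require Import ring zify.

Set Implicit Arguments.
Unset Strict Implicit.
Unset Printing Implicit Defensive.

Import GRing.Theory.

Local Open Scope classical_set_scope.
Local Open Scope ring_scope.

(** The theorem is a splitting of torsion.  Put n0 = [K0 : Q], n1 = [K1 : K0],
    n2 = [K2 : K0]; since these are pairwise coprime, [L : K1] = n2 and
    [L : K2] = n1.  For Galois fields K <= E over the rationals three facts hold.
    - Extension of ideals maps Po(K) into Po(E), and the image contains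
      [E : K] Po(E); moreover [K : Q] kills Po(K).
    - If an ideal of K becomes principal in E, its relative norm shows that
      [E : K] kills its class in Cl(K).
    - The extensions along K0 <= K1 <= L and K0 <= K2 <= L agree.
    So Po(K0) is the n0-part of each of the groups, it injects into Po(K1) and
    Po(K2), the quotient Po(Ki)/Po(K0) is the ni-part of Po(Ki), it injects into
    Po(L), and Po(L) is the sum of these three parts.  This last deduction only
    concerns abelian groups ([coprime_amalgam]).

    The arithmetic rests on one description: for K Galois over the rationals,
    Po(K) consists of the classes of the ideals that are fixed by all
    automorphisms ([polyaP]).  Each ideal Pi_q is invariant by construction.
    Conversely, the Galois group permutes transitively the maximal ideals above a
    prime number, so an invariant integral ideal inside a maximal ideal P of norm
    q lies in Pi_q, which can be divided out; the absolute norm decreases.  With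
    this description the facts above become statements on norms of ideals: if I
    is invariant, the product of its conjugates over K is a power of I.

    Norms of ideals are obtained from polynomials, in the manner of Kronecker.  A
    finitely generated ideal I is the content of a polynomial f.  The product of
    the conjugates of f has coefficients in the smaller field, and contents are
    multiplicative; hence the product of the conjugates of I is extended from the
    smaller field ([norm_idealE]).  Over the rationals this content is principal,
    which also proves that I is invertible ([content_invertible]).  Multiplicativity
    comes from the theorem that if u times every coefficient of f g is integral,
    so is u times every product of a coefficient of f and one of g
    ([kronecker_content]), a consequence of the Dedekind-Mertens lemma and of the
    criterion that a number stabilising a nonzero finitely generated module is
    integral.  Maximal ideals are finitely generated because at most [M : Q]
    elements are linearly independent modulo a prime ([residue_basis]). *)

(** * Integrality and contents of products *)

Section Integrality.
Variable M : fieldExtType rat.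

Definition algint : {pred M} :=
  fun x => `[< integralOver (intr : int -> M) x >].

Fact algint_subring : subring_closed algint.
Proof.
split; first exact/asboolP/integral1.
  by move=> x y /asboolP ix /asboolP iy; exact/asboolP/integral_sub.
by move=> x y /asboolP ix /asboolP iy; exact/asboolP/integral_mul.
Qed.

HB.instance Definition _ :=
  GRing.isSubringClosed.Build M algint algint_subring.

(** [u] is an eigenvalue of a matrix of algebraic integers, hence a root of its
    characteristic polynomial, which is monic with integral coefficients. *)
Lemma stable_integral (I : finType) (v : I -> M) (A : I -> I -> M) u i0 :
    v i0 != 0 -> (forall i j, A i j \in algint) ->
    (forall i, u * v i = \sum_j A i j * v j) ->
  u \in algint.
Proof.
move=> v0 Aint uv.
pose B := (\matrix_(i, j) A (enum_val j) (enum_val i)) : 'M[M]_#|I|.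
have : eigenvalue B u.
  apply/eigenvalueP; exists (\row_j v (enum_val j)); last first.
    apply: contraNneq v0 => /rowP/(_ (enum_rank i0)).
    by rewrite !mxE enum_rankK => ->.
  apply/rowP=> i; rewrite !mxE uv (reindex _ (onW_bij _ (enum_val_bij I))).
  apply: eq_bigr => j _ /=.
  by rewrite !mxE mulrC.
rewrite eigenvalue_root_char => rootu.
apply/asboolP/(integral_root_monic (char_poly_monic B) rootu)/integral_poly => i.
apply/asboolP; have /polyOverP : char_poly B \is a polyOver algint; last exact.
rewrite /char_poly /char_poly_mx; apply: rpred_sum => s _.
apply: rpredM; first by apply: rpredX; rewrite rpredN rpred1.
apply: rpred_prod => j _; rewrite !mxE rpredB ?polyOverC ?Aint//.
by apply: rpredMn; exact: polyOverX.
Qed.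

End Integrality.

Section Kronecker.
Variable M : fieldExtType rat.
Implicit Types (f g : {poly M}).

(** The Dedekind-Mertens lemma c(f)^(n+1) c(g) <= c(f)^n c(fg), stated for an
    arbitrary additive group [T] in place of c(f)^n c(fg).  This freedom makes
    the induction short: it is applied to the groups of those [x] such that
    f_k x lies in [T]. *)
Lemma dedekind_mertens n (T : M -> Prop) f g :
    T 0 -> (forall x y, T x -> T y -> T (x - y)) -> (size g <= n.+1)%N ->
    (forall k s, size s = n -> T ((f * g)`_k * \prod_(i <- s) f`_i)) ->
  forall j s, size s = n.+1 -> T (g`_j * \prod_(i <- s) f`_i).
Proof.
elim: n T g => [|n IHn] T g T0 TB sg Tfg j s ss.
  case: s ss => [|i [|//]] //= _; rewrite big_seq1.
  have [j0|j0] := posnP j; last by rewrite nth_default ?mul0r// (leq_trans sg).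
  have := Tfg i [::] erefl; rewrite big_nil mulr1 (size1_polyC sg) coefMC.
  by rewrite j0 coefC eqxx mulrC.
have TN x : T x -> T (- x) by move=> Tx; rewrite -sub0r; exact: TB.
have TD x y : T x -> T y -> T (x + y).
  by move=> Tx Ty; rewrite -[y]opprK; apply/TB => //; exact: TN.
have Tsum (I : Type) (r : seq I) (P : pred I) F :
    (forall i, P i -> T (F i)) -> T (\sum_(i <- r | P i) F i).
  by move=> TF; exact: big_ind.
pose b := g`_n.+1; pose g' := g - b *: 'X^(n.+1).
have sg' : (size g' <= n.+1)%N.
  apply/leq_sizeP => k; rewrite leq_eqVlt => /predU1P[<-|nk].
    by rewrite coefB coefZ coefXn eqxx mulr1 subrr.
  by rewrite coefB coefZ coefXn gtn_eqF// mulr0 subr0 nth_default// (leq_trans sg).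
have g'E k : (k <= n)%N -> g'`_k = g`_k.
  by move=> kn; rewrite coefB coefZ coefXn ltn_eqF// mulr0 subr0.
have fg'E k : (f * g')`_k =
    (f * g)`_k - (if (k < n.+1)%N then 0 else b * f`_(k - n.+1)).
  rewrite /g' mulrBr -scalerAr coefB coefZ coefMXn.
  by case: ifP => _; rewrite ?mulr0.
(* The products with the top coefficient [b] of [g] are reached by descending *)
(* induction on the index of one of the coefficients of [f].                  *)
pose Q i := forall t, size t = n.+1 -> T (f`_i * (b * \prod_(l <- t) f`_l)).
have step k l t : Q k -> (l <= n)%N -> size t = n.+1 ->
    T (f`_k * (g`_l * \prod_(m <- t) f`_m)).
  move=> Qk ln st; rewrite -g'E//.
  apply: (IHn (fun x => T (f`_k * x))) => //; first by rewrite mulr0.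
    by move=> x y Tx Ty; rewrite mulrBr; exact: TB.
  move=> m w sw; rewrite fg'E mulrBl mulrBr; apply: TB.
    by rewrite mulrCA -(big_cons _ _ k w xpredT); apply: Tfg; rewrite /= sw.
  case: ifP => _; first by rewrite mul0r mulr0.
  by rewrite -mulrA -(big_cons _ _ (m - n.+1)%N w xpredT); apply: Qk => //=; rewrite sw.
have Qall i : Q i.
  have [m] := ubnP (size f - i)%N; elim: m i => // m IHm i mi.
  have [si|si] := leqP (size f) i; first by move=> t st; rewrite nth_default ?mul0r.
  have Qi k : (i < k)%N -> Q k.
    by move=> ik; apply: IHm; move: mi si ik; clear; lia.
  move=> t st; have := Tfg (i + n.+1)%N t st; set w := \prod_(l <- t) _.
  rewrite coefMr (bigD1 (inord n.+1)) //= inordK ?addnK; last first.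
    by rewrite ltnS leq_addl.
  set S := \sum_(_ < _ | _) _ => TS.
  suff TSw : T (S * w).
    by have := TB _ _ TS TSw; rewrite mulrDl addrK mulrA.
  rewrite /S mulr_suml; apply: Tsum => l ln; rewrite -mulrA.
  have [ln1|ln1] := leqP n.+2 l.
    by rewrite [g`_l]nth_default ?mul0r ?mulr0 ?(leq_trans sg)//; exact: T0.
  have ln2 : (l <= n)%N.
    rewrite -ltnS ltn_neqAle -ltnS ln1 andbT; apply: contra_neq ln => ln.
    by apply: val_inj; rewrite /= inordK// ltnS leq_addl.
  by apply: step => //; apply: Qi; move: ln2 ln1 ln; clear; lia.
case: s ss => // i s [ss]; rewrite big_cons mulrCA.
have [jn|jn] := leqP j n; last first.
  have [jn1|jn1] := leqP n.+2 j.
    by rewrite [g`_j]nth_default ?mul0r ?mulr0 ?(leq_trans sg).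
  by have -> : j = n.+1 by [move: jn jn1; clear; lia]; exact: Qall.
by apply: step.
Qed.

(** With n = size g, the products of n coefficients of [f] span a finitely
    generated module over the algebraic integers, and by the Dedekind-Mertens lemma
    multiplication by u f_i g_j stabilises it. *)
Lemma kronecker_content f g u :
    (forall k, u * (f * g)`_k \in @algint M) ->
  forall i j, u * (f`_i * g`_j) \in @algint M.
Proof.
move=> ufg i j.
have [->|fi0] := eqVneq f`_i 0; first by rewrite mul0r mulr0 rpred0.
have ltif : (i < size f)%N.
  by rewrite ltnNge; apply: contra fi0 => ?; rewrite nth_default.
pose I := (size g).-tuple 'I_(size f).
pose v (t : I) := \prod_(l <- t) f`_(l : 'I_(size f)).
pose T x := exists c : I -> M,
  (forall t, c t \in @algint M) /\ u * x = \sum_t c t * v t.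
have Tg l s : size s = (size g).+1 -> T (g`_l * \prod_(m <- s) f`_m).
  apply: dedekind_mertens => // [|x y [c [cI xE]] [d [dI yE]]|k {}s ss].
  - exists (fun=> 0); split=> [t|]; first exact: rpred0.
    by rewrite big1 ?mulr0// => t _; rewrite mul0r.
  - exists (fun t => c t - d t); split=> [t|]; first exact: rpredB (cI t) (dI t).
    rewrite mulrBr xE yE -sumrB; apply: eq_bigr => t _; exact/esym/mulrBl.
  have [sm|/allPn[m ms mf]] := boolP (all (fun m => m < size f)%N s); last first.
    exists (fun=> 0); split=> [t|]; first exact: rpred0.
    rewrite [RHS]big1 => [|t _]; last by rewrite mul0r.
    by rewrite (big_rem m)//= [f`_m]nth_default ?mul0r ?mulr0// leqNgt.
  have [t tE] : exists t : I, map val t = s.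
    have st : size (pmap insub s : seq 'I_(size f)) == size g.
      by rewrite size_pmap_sub -ss -all_count.
    exists (Tuple st); rewrite /= (pmap_filter (insubK _)).
    by apply/all_filterP/allP => x xs; rewrite /= insubT ?(allP sm).
  exists (fun t' => if t' == t then u * (f * g)`_k else 0); split=> [t'|].
    by case: ifP => _; rewrite ?rpred0.
  rewrite (bigD1 t)//= eqxx [X in _ = _ + X]big1 ?addr0 => [|t' tt']; last first.
    by rewrite (negPf tt') mul0r.
  by rewrite mulrA; congr (_ * _); rewrite -tE big_map.
have /boolp.choice[A AP] t : exists a : I -> M, (forall t', a t' \in @algint M)
    /\ u * (f`_i * g`_j) * v t = \sum_t' a t' * v t'.
  have /(_ _)[|c [cI cE]] := Tg j (i :: map val t).
    by rewrite /= size_map size_tuple.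
  exists c; split=> //; rewrite -cE big_cons big_map -/(v t).
  by rewrite -mulrA [f`_i * _]mulrC !mulrA.
(* The spanning family is not zero: it contains the power of f_i. *)
apply: (@stable_integral _ I v A _ [tuple Ordinal ltif | _ < size g]).
- by rewrite prodf_seq_neq0; apply/allP => _ /mapP[l _ ->].
- by move=> t t'; have [] := AP t.
- by move=> t; have [] := AP t.
Qed.

End Kronecker.

Section RationalIntegers.
Variable M : fieldExtType rat.
Implicit Types x : M.

Lemma intr_field_eq0 (z : int) : (z%:~R == 0 :> M) = (z == 0).
Proof.
have -> : z%:~R = in_alg M z%:~R by rewrite rmorph_int.
by rewrite fmorph_eq0 intr_eq0.
Qed.

Lemma natr_field_eq0 (n : nat) : (n%:R == 0 :> M) = (n == 0%N).
Proof. by rewrite -[n%:R]/((Posz n)%:~R) intr_field_eq0. Qed.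

Lemma intr_field_inj : injective (intr : int -> M).
Proof.
move=> x y /eqP; rewrite -subr_eq0 -rmorphB /= intr_field_eq0 subr_eq0.
exact: eqP.
Qed.

(** The statement is transported to the algebraic complex numbers, where
    rational algebraic integers are known to be integers. *)
Lemma rational_integral x : x \in 1%VS -> x \in @algint M -> exists z : int, x = z%:~R.
Proof.
move=> /vlineP[q ->] /asboolP[p p1 /rootP px].
have [z zE] : exists z : int, q = z%:~R.
  have qA : ratr q \in Aint.
    apply: (@root_monic_Aint (map_poly intr p)).
    - have -> : map_poly intr p = map_poly ratr (map_poly (intr : int -> rat) p)
          :> {poly algC}.
        by rewrite -map_poly_comp; apply: eq_map_poly => i /=; rewrite ratr_int.
      rewrite fmorph_root; apply/rootP/(fmorph_inj (in_alg M)).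
      rewrite rmorph0 -horner_map /= -map_poly_comp -[RHS]px; congr (_.[_]).
      by apply: eq_map_poly => i /=; rewrite scaler_int.
    - exact: monic_map.
    - by apply/polyOverP => i; rewrite coef_map; exact: Num.Theory.intr_int.
  have /Num.Theory.intrP[z zE] := Cint_rat_Aint (Crat_rat q) qA.
  by exists z; apply: (fmorph_inj (ratr : rat -> algC)); exact: etrans zE (esym (ratr_int _ _)).
by exists z; rewrite zE scaler_int.
Qed.

(** In a basis of [M] over the rationals, multiplication by [x] is a rational
    matrix; after clearing denominators it preserves the lattice spanned by the
    basis. *)
Lemma integral_denominator x : exists2 d : nat, (0 < d)%N & d%:R * x \in @algint M.
Proof.
pose e := vbasis {:M}; pose n := \dim {:M}.
pose q (i j : 'I_n) : rat := coord e j (x * e`_i).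
pose d := \prod_(ij : 'I_n * 'I_n) `|denq (q ij.1 ij.2)|%N.
have d0 : (0 < d)%N by apply: prodn_gt0 => ij; rewrite absz_gt0 denq_eq0.
exists d => //.
have dq i j : exists z : int, d%:R * q i j = z%:~R.
  rewrite /d (bigD1 (i, j))//= natrM mulrAC.
  have -> : (`|denq (q i j)|%N)%:R * q i j = (numq (q i j))%:~R.
    by rewrite numqE mulrC -[in RHS]absz_denq.
  by eexists (numq (q i j) * Posz _); rewrite rmorphM /=; congr (_ * _).
have [A AE] := boolp.choice (fun ij : 'I_n * 'I_n => dq ij.1 ij.2).
have n0 : (0 < n)%N by rewrite /n adim_gt0.
apply: (@stable_integral M _ (fun i : 'I_n => e`_i)
   (fun i j => (A (i, j))%:~R) _ (Ordinal n0)).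
- by apply: (basis_not0 (vbasisP {:M})); rewrite mem_nth ?size_tuple.
- by move=> i j; apply: rpred_int.
move=> i; rewrite -mulrA [x * _](coord_vbasis (memvf _)) mulr_sumr.
apply: eq_bigr => j _; have := AE (i, j) => /= AE'.
by rewrite [RHS]mulrzl -scaler_int -AE' [LHS]mulr_natl -scalerA scaler_nat.
Qed.

Lemma int_ideal_gcd (s : seq int) : exists d : int,
  (forall i, (d %| s`_i)%Z) /\ exists c : nat -> int, d = \sum_(i < size s) c i * s`_i.
Proof.
elim: s => [|a s [d [ds [c dE]]]].
  exists 0; split=> [i|]; first by rewrite nth_nil.
  by exists (fun=> 0); rewrite big_ord0.
have [u [v uvE]] := Bezoutz a d; exists (gcdz a d); split=> [[|i]|] /=.
- exact: dvdz_gcdl.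
- exact: dvdz_trans (dvdz_gcdr _ _) (ds i).
exists (fun i => if i is j.+1 then v * c j else u).
rewrite big_ord_recl /= -uvE dE mulr_sumr; congr (_ + _).
by apply: eq_bigr => i _; rewrite mulrA.
Qed.

End RationalIntegers.

(** * The content ideal of a polynomial *)

Section Content.
Variable M : fieldExtType rat.
Implicit Types (K E : {subfield M}) (I J : set M) (f g h : {poly M}) (x y : M).
Local Notation O := (@ring_of_integers M).

Lemma ring_of_integersP K x : O K x <-> x \in K /\ x \in @algint M.
Proof. by split=> -[Kx /asboolP ix]; split=> //; apply/asboolP. Qed.

Lemma ring_of_integers_int K (z : int) : O K z%:~R.
Proof. by apply/ring_of_integersP; split; apply: rpred_int. Qed.

Section Submodules.
Variables (K : {subfield M}) (I : set M) (subI : integer_submodule K I).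

Lemma submoduleN x : I x -> I (- x).
Proof.
case: subI => _ _ IM Ix; rewrite -mulN1r; apply: IM => //.
exact/ring_of_integersN/ring_of_integers1.
Qed.

Lemma submoduleB x y : I x -> I y -> I (x - y).
Proof. by case: subI => _ ID _ Ix Iy; apply: ID => //; apply: submoduleN. Qed.

Lemma submodule_sum (T : Type) (r : seq T) (P : pred T) F :
  (forall i, P i -> I (F i)) -> I (\sum_(i <- r | P i) F i).
Proof. by case: subI => I0 ID _ IF; apply: big_ind. Qed.

End Submodules.

Lemma invertible_principal K a : a \in K -> a != 0 ->
  invertible_ideal K (principal_ideal K a).
Proof.
have fP b : b \in K -> b != 0 -> fractional_ideal K (principal_ideal K b).
  move=> Kb b0; split; last 1 first.
  - have [e e0 eb] := integral_denominator b.
    exists e%:R; split.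
    + by rewrite -[_%:R]/((Posz e)%:~R); apply: ring_of_integers_int.
    + by rewrite natr_field_eq0 -lt0n.
    move=> _ [x Ox <-]; rewrite mulrA; apply: ring_of_integersM => //.
    by apply/ring_of_integersP; split=> //; rewrite rpredM ?rpred_nat.
  - by move=> _ [x [Kx _] <-]; apply: rpredM.
  - exact: integer_submodule_principal.
move=> Ka a0; split; first exact: fP.
exists (principal_ideal K a^-1); first by apply: fP; rewrite ?rpredV ?invr_eq0.
by rewrite principal_ideal_mul divff// principal_ideal1.
Qed.

Lemma invertible_mull K I J : fractional_ideal K I -> fractional_ideal K J ->
  invertible_ideal K (ideal_mul I J) -> invertible_ideal K I.
Proof.
move=> fI fJ [_ [N fN IJN]]; split=> //; exists (ideal_mul J N).
  exact: fractional_ideal_mul.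
by rewrite ideal_mulA.
Qed.

(** Contents are used as a representation of finitely generated submodules: the
    generators are the coefficients, so that products of ideals become products of
    polynomials. *)
Definition content K f : set M :=
  [set x | exists2 c : nat -> M,
    (forall i, O K (c i)) & x = \sum_(i < size f) c i * f`_i].

Lemma content_submodule K f : integer_submodule K (content K f).
Proof.
split=> [|_ _ [c cO ->] [d dO ->]|a _ Oa [c cO ->]].
- exists (fun=> 0); first by move=> _; apply: ring_of_integers0.
  by rewrite big1 // => i _; rewrite mul0r.
- exists (fun i => c i + d i); first by move=> i; apply: ring_of_integersD.
  by rewrite -big_split; apply: eq_bigr => i _; rewrite mulrDl.
- exists (fun i => a * c i); first by move=> i; apply: ring_of_integersM.
  by rewrite mulr_sumr; apply: eq_bigr => i _; rewrite mulrA.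
Qed.

Lemma content_coef K f i : content K f f`_i.
Proof.
have [si|si] := leqP (size f) i.
  by rewrite nth_default//; case: (content_submodule K f).
exists (fun j => (j == i)%:R) => [j|].
  by case: eqP => _; [apply: ring_of_integers1|apply: ring_of_integers0].
rewrite (bigD1 (Ordinal si))//= eqxx mul1r big1 ?addr0// => j.
by rewrite -val_eqE /= => /negPf->; rewrite mul0r.
Qed.

Lemma content_min K f I : integer_submodule K I -> (forall i, I f`_i) ->
  content K f `<=` I.
Proof.
move=> subI If _ [c cO ->]; apply: (submodule_sum subI) => i _.
by case: subI => _ _; apply.
Qed.

Lemma content_ext K E f : (K <= E)%VS ->
  content E f = ideal_mul (content K f) (O E).
Proof.
move=> KE; rewrite eqEsubset; split.
  apply: content_min => [|i].
    rewrite ideal_mulC; apply: integer_submodule_mul; exact: integer_submodule_O.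
  rewrite -[f`_i]mulr1; apply: ideal_mul_incl; first exact: content_coef.
  exact: ring_of_integers1.
case: (content_submodule E f) => C0 CD CM; apply: ideal_mul_min => // x y.
move=> [c cO ->] Oy; rewrite mulrC; apply: (CM) => //.
apply: (submodule_sum (content_submodule E f)) => i _; apply: CM.
  exact: ring_of_integersS KE _ (cO i).
exact: content_coef.
Qed.

Lemma content_fractional K f : f \is a polyOver K ->
  fractional_ideal K (content K f).
Proof.
move=> /polyOverP Kf; split; last 1 first.
- have /boolp.choice[d dP] i : exists d : nat, (0 < d)%N /\ d%:R * f`_i \in @algint M.
    by have [d d0 df] := integral_denominator f`_i; exists d.
  pose D := (\prod_(i < size f) d i)%N; exists D%:R; split.
  + by rewrite -[D%:R]/((Posz D)%:~R); apply: ring_of_integers_int.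
  + by rewrite natr_field_eq0 -lt0n prodn_gt0// => i; have [] := dP i.
  move=> _ [c cO ->]; rewrite mulr_sumr.
  apply: (submodule_sum (integer_submodule_O K)) => i _.
  rewrite mulrCA; apply: ring_of_integersM => //.
  apply/ring_of_integersP; split; first by rewrite rpredM ?rpred_nat.
  rewrite /D (bigD1 i)//= natrM mulrAC mulrC; apply: rpredM; first exact: rpred_nat.
  by have [] := dP i.
- move=> _ [c cO ->]; apply: rpred_sum => i _; apply: rpredM; last exact: Kf.
  by have [] := cO i.
- exact: content_submodule.
Qed.

Lemma content_mul_integral K f g u x y :
    (forall k, u * (f * g)`_k \in @algint M) ->
  content K f x -> content K g y -> u * (x * y) \in @algint M.
Proof.
move=> ufg [c cO ->] [d dO ->]; rewrite mulr_suml mulr_sumr.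
apply: rpred_sum => i _; rewrite !mulr_sumr; apply: rpred_sum => j _.
have /ring_of_integersP[_ ic] := cO i; have /ring_of_integersP[_ id] := dO j.
have -> : u * (c i * f`_i * (d j * g`_j)) = c i * d j * (u * (f`_i * g`_j)) by ring.
by rewrite rpredM ?(rpredM ic id) ?kronecker_content.
Qed.

(** Gauss's lemma.  Only the inclusion of c(f) c(g) in c(fg) is not formal: if [J]
    is the inverse of c(fg), then J c(f) c(g) is integral by Kronecker's theorem. *)
Lemma content_mul K f g : f \is a polyOver K -> g \is a polyOver K ->
    invertible_ideal K (content K (f * g)) ->
  content K (f * g) = ideal_mul (content K f) (content K g).
Proof.
move=> /content_fractional[Kf _ _] /content_fractional[Kg _ _] [_ [J [JK _ _] CJ]].
have [C0 CD CM] := content_submodule K (f * g).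
rewrite eqEsubset; split.
  apply: content_min => [|k]; first exact/integer_submodule_mul/content_submodule.
  rewrite coefM; apply: submodule_sum.
    exact/integer_submodule_mul/content_submodule.
  by move=> i _; apply: ideal_mul_incl; apply: content_coef.
apply: ideal_mul_min => // x y fx gy; rewrite -[x * y]mul1r.
have : ideal_mul (content K (f * g)) J 1 by rewrite CJ; apply: ring_of_integers1.
move: 1; apply: (ideal_mul_min (H := fun z => content K (f * g) (z * (x * y)))).
- by rewrite mul0r.
- by move=> s t; rewrite mulrDl; apply: CD.
move=> c u Cc Ju; rewrite -mulrA [c * _]mulrC; apply: CM => //.
apply/ring_of_integersP; split; first by rewrite !rpredM ?(JK u) ?(Kf x) ?(Kg y).
apply: (content_mul_integral _ fx gy) => k.
have : O K ((f * g)`_k * u) by rewrite -CJ; apply/ideal_mul_incl/Ju/content_coef.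
by rewrite mulrC => /ring_of_integersP[].
Qed.

(** The integers are principal: up to a common denominator, the content is
    generated by the greatest common divisor of the coefficients. *)
Lemma content_rational K h : h \is a polyOver 1%VS -> h != 0 ->
  exists d, [/\ d \in 1%VS, d != 0 & content K h = principal_ideal K d].
Proof.
move=> h1 h0; have [_ _ [d [Od d0 dh]]] := @content_fractional 1%AS h h1.
have d1 : d \in 1%VS by case: Od.
have /boolp.choice[z zE] i : exists z : int, d * h`_i = z%:~R.
  by have /ring_of_integersP[] := dh _ (content_coef 1%AS h i); apply: rational_integral.
have [g [gz [c gE]]] := int_ideal_gcd (mkseq z (size h)).
have {}gz i : (g %| z i)%Z.
  have [si|si] := leqP (size h) i; last by have := gz i; rewrite nth_mkseq.
  suff -> : z i = 0 by rewrite dvdz0.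
  by apply: (@intr_field_inj M); rewrite -zE nth_default// mulr0.
have hE i : h`_i = g%:~R / d * (z i %/ g)%Z%:~R.
  by rewrite mulrAC -rmorphM /= [g * _]mulrC divzK// -zE mulrC mulKf.
have g0 : g%:~R != 0 :> M.
  apply: contraNneq h0 => g0; apply/eqP/polyP => i.
  by rewrite hE g0 !mul0r coef0.
exists (g%:~R / d); split.
- by rewrite rpredM ?rpred_int// rpredV.
- by rewrite mulf_neq0// invr_eq0.
rewrite eqEsubset; split.
  apply: content_min => [|i]; first exact: integer_submodule_principal.
  by rewrite hE; exists (z i %/ g)%Z%:~R => //; exact: ring_of_integers_int.
move=> _ [x Ox <-]; rewrite mulrC; case: (content_submodule K h) => _ _; apply=> //.
rewrite gE rmorph_sum mulr_suml /=; apply: (submodule_sum (content_submodule K h)) => i _.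
rewrite size_mkseq in i *.
rewrite nth_mkseq// rmorphM /= -zE [d * _]mulrC mulrA mulfK//.
by case: (content_submodule K h) => _ _; apply;
  [exact: ring_of_integers_int|exact: content_coef].
Qed.

(** If I J is the ring of integers, write 1 as a sum of products x_i y_i; then the
    x_i generate I. *)
Lemma invertible_content K I : invertible_ideal K I ->
  exists f, [/\ f \is a polyOver K, f != 0 & I = content K f].
Proof.
move=> [[IK subI _] [J [JK _ _] IJ]].
have [s [sIJ sE]] : ideal_mul I J 1 by rewrite IJ; apply: ring_of_integers1.
pose f := Poly (unzip1 s); have fE i : f`_i = (unzip1 s)`_i by rewrite coef_Poly.
have If i : I f`_i.
  rewrite fE; have [si|si] := leqP (size s) i.
    by rewrite nth_default ?size_map//; case: subI.
  by rewrite (nth_map 0)//; have [] := sIJ _ (mem_nth 0 si).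
have Kf i : f`_i \in K by apply: IK.
have IE : I = content K f.
  rewrite eqEsubset; split; last exact: content_min.
  move=> x Ix; rewrite -[x]mulr1 sE mulr_sumr (big_nth 0) big_mkord.
  apply: (submodule_sum (content_submodule K f)) => i _.
  have [_ Js] := sIJ _ (mem_nth 0 (ltn_ord i)).
  rewrite [(s`_i).1 * _]mulrC mulrA; case: (content_submodule K f) => _ _; apply.
    by rewrite -IJ; apply: ideal_mul_incl.
  by rewrite -(nth_map 0 0 fst)// -fE; apply: content_coef.
exists f; split=> //; first exact/polyOverP.
apply: contra_neqN (oner_neq0 M) => /eqP f0.
rewrite sE big_seq big1// => p /sIJ[+ _]; rewrite IE f0 => -[c _ ->].
by rewrite size_poly0 big_ord0 mul0r.
Qed.

End Content.

(** * Conjugate ideals and norms *)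

Section Action.
Variable M : splittingFieldType rat.
Implicit Types (K E : {subfield M}) (I J : set M) (f g h : {poly M}) (x y : M).
Implicit Types (phi : 'AEnd(M)).
Local Notation O := (@ring_of_integers M).

Lemma AEnd_algint phi x : x \in @algint M -> phi x \in @algint M.
Proof.
move=> /asboolP[p p1 /rootP px]; apply/asboolP; exists p => //; apply/rootP.
rewrite -[RHS](rmorph0 phi) -px -horner_map -map_poly_comp; congr (_.[_]).
by apply: eq_map_poly => z /=; rewrite rmorph_int.
Qed.

Lemma AEnd_invK phi : cancel (phi^-1)%AF phi.
Proof. by move=> x; rewrite /= lker0_lfunVK ?AEnd_lker0. Qed.

Lemma galois_img K phi : galois 1 K -> (phi @: K)%VS = K.
Proof.
move=> /and3P[_ _ /forall_inP nK]; apply/eqP/nK.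
by rewrite inE kAutfE k1AHom.
Qed.

Section Stable.
Variables (K : {subfield M}) (phi : 'AEnd(M)) (phiK : (phi @: K)%VS = K).

Lemma AEnd_mem x : x \in K -> phi x \in K.
Proof. by move/(memv_img phi); rewrite phiK. Qed.

Lemma AEnd_memV x : x \in K -> (phi^-1)%AF x \in K.
Proof.
rewrite -{1}phiK => /memv_imgP[y Ky ->] /=.
by rewrite lker0_lfunK ?AEnd_lker0.
Qed.

Lemma AEnd_O x : O K x -> O K (phi x).
Proof.
move=> /ring_of_integersP[Kx ix]; apply/ring_of_integersP.
by split; [exact: AEnd_mem|exact: AEnd_algint].
Qed.

Lemma AEnd_OV x : O K x -> O K ((phi^-1)%AF x).
Proof.
move=> /ring_of_integersP[Kx ix]; apply/ring_of_integersP.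
by split; [exact: AEnd_memV|exact: AEnd_algint].
Qed.

Lemma image_ring_of_integers : phi @` O K = O K.
Proof.
rewrite eqEsubset; split=> [_ [x Ox <-]|x Ox]; first exact: AEnd_O.
by exists ((phi^-1)%AF x); [exact: AEnd_OV|exact: AEnd_invK].
Qed.

Lemma image_submodule I : integer_submodule K I -> integer_submodule K (phi @` I).
Proof.
move=> [I0 ID IM]; split.
- by exists 0; rewrite ?rmorph0.
- by move=> _ _ [x Ix <-] [y Iy <-]; exists (x + y); [apply: ID|rewrite rmorphD].
move=> a _ Oa [x Ix <-]; exists ((phi^-1)%AF a * x).
  by apply: IM => //; apply: AEnd_OV.
by rewrite rmorphM; congr (_ * _); apply: AEnd_invK.
Qed.

Lemma image_fractional I : fractional_ideal K I -> fractional_ideal K (phi @` I).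
Proof.
move=> [IK subI [d [Od d0 dI]]]; split; last 1 first.
- exists (phi d); split; [exact: AEnd_O|by rewrite fmorph_eq0|].
  by move=> _ [x Ix <-]; rewrite -rmorphM; apply/AEnd_O/dI.
- by move=> _ [x Ix <-]; apply/AEnd_mem/IK.
- exact: image_submodule.
Qed.

Lemma image_content f : phi @` content K f = content K (map_poly phi f).
Proof.
rewrite eqEsubset; split.
  move=> _ [_ [c cO ->] <-]; rewrite rmorph_sum.
  apply: (submodule_sum (content_submodule _ _)) => i _; rewrite rmorphM /= -coef_map.
  case: (content_submodule K (map_poly phi f)) => _ _; apply; first exact: AEnd_O.
  exact: content_coef.
apply: content_min => [|i]; first exact/image_submodule/content_submodule.
by rewrite coef_map; exists f`_i => //; apply: content_coef.
Qed.

Lemma image_principal a : phi @` principal_ideal K a = principal_ideal K (phi a).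
Proof.
rewrite /principal_ideal -[in RHS]image_ring_of_integers !image_comp.
by apply: eq_imagel => x _ /=; rewrite rmorphM.
Qed.

End Stable.

Lemma image_ideal_mul phi I J :
  phi @` ideal_mul I J = ideal_mul (phi @` I) (phi @` J).
Proof.
rewrite eqEsubset; split.
  move=> _ [x IJx <-]; move: x IJx.
  apply: (ideal_mul_min (H := fun x => ideal_mul (phi @` I) (phi @` J) (phi x))).
  - by rewrite rmorph0; apply: ideal_mul0.
  - by move=> x y; rewrite rmorphD; apply: ideal_mulD.
  - by move=> x y Ix Jy; rewrite rmorphM; apply: ideal_mul_incl; [exists x|exists y].
apply: ideal_mul_min.
- by exists 0; rewrite ?rmorph0//; apply: ideal_mul0.
- move=> _ _ [x IJx <-] [y IJy <-]; exists (x + y); last by rewrite rmorphD.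
  exact: ideal_mulD.
move=> _ _ [x Ix <-] [y Jy <-]; exists (x * y); last by rewrite rmorphM.
exact: ideal_mul_incl.
Qed.

Lemma image_invertible K phi I : (phi @: K)%VS = K ->
  invertible_ideal K I -> invertible_ideal K (phi @` I).
Proof.
move=> phiK [fI [J fJ IJ]]; split; first exact: image_fractional.
exists (phi @` J); first exact: image_fractional.
by rewrite -image_ideal_mul IJ image_ring_of_integers.
Qed.

(** The condition that [phi] preserves [K], under which the default value of
    [insubd] is not reached ([conj_idealE]), is kept out of the definition so that
    conjugates can be summed over a Galois group without carrying proofs. *)
Definition conj_ideal K phi (I : idealGroup K) : idealGroup K :=
  insubd I (phi @` (I : set M)).

Lemma conj_idealE K phi (I : idealGroup K) : (phi @: K)%VS = K ->
  ideal_set (conj_ideal phi I) = phi @` (I : set M).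
Proof.
move=> phiK; rewrite -[ideal_set _]/(val _) val_insubd; case: asboolP => // -[].
exact/image_invertible/idealGroupP.
Qed.

Definition norm_poly (K E : {subfield M}) (f : {poly M}) : {poly M} :=
  \prod_(s in 'Gal(E / K)%g) map_poly (gal_repr s) f.

Lemma map_poly_gal_over E (s : gal_of E) f :
  f \is a polyOver E -> map_poly s f \is a polyOver E.
Proof.
by move=> /polyOverP Ef; apply/polyOverP => i; rewrite coef_map memv_gal.
Qed.

Lemma norm_poly_over K E f : galois K E -> f \is a polyOver E ->
  norm_poly K E f \is a polyOver K.
Proof.
move=> galKE Ef; have EN : norm_poly K E f \is a polyOver E.
  by apply: rpred_prod => s _; apply: map_poly_gal_over.
apply/polyOverP => i; rewrite -(galois_fixedField galKE).
apply/fixedFieldP => [|s galEs]; first exact: (polyOverP EN).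
rewrite -coef_map; suff -> : map_poly s (norm_poly K E f) = norm_poly K E f by [].
rewrite /norm_poly [in RHS](reindex_inj (mulIg s)) rmorph_prod /=.
apply: eq_big => [t|t _]; first by rewrite groupMr.
apply/polyP => j; rewrite !coef_map /=.
by rewrite galM ?lfunE// (polyOverP Ef).
Qed.

Lemma norm_poly_neq0 K E f : f != 0 -> norm_poly K E f != 0.
Proof. by move=> f0; apply/prodf_neq0 => s _; rewrite map_poly_eq0. Qed.

(** The norm of [f] is a multiple f g with rational coefficients, so c(f) c(g) is
    principal. *)
Lemma content_invertible K f : galois 1 K -> f \is a polyOver K -> f != 0 ->
  invertible_ideal K (content K f).
Proof.
move=> galK Kf f0.
have [d [d1 d0 hd]] := content_rational K (norm_poly_over galK Kf) (norm_poly_neq0 1 K f0).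
have iN : invertible_ideal K (content K (norm_poly 1 K f)).
  by rewrite hd; apply: invertible_principal => //; apply: (subvP (sub1v K)).
have [g Kg fg] : exists2 g, g \is a polyOver K & norm_poly 1 K f = f * g.
  exists (\prod_(s in 'Gal(K / 1)%g | s != 1%g) map_poly (gal_repr s) f).
    by apply: rpred_prod => s _; apply: map_poly_gal_over.
  rewrite /norm_poly (bigD1 1%g)//=; congr (_ * _); apply/polyP => i.
  by rewrite coef_map /= gal_id.
move: iN; rewrite fg => iN; have := iN; rewrite content_mul//.
by apply: invertible_mull; apply: content_fractional.
Qed.

(** The product of the conjugates of [I] (a sum in the additively written group of
    ideals) is the content of a polynomial over [K], hence extended from [K]. *)
Lemma norm_idealE K E (I : idealGroup E) : galois K E -> galois 1 E ->
  exists h, [/\ h \is a polyOver K, h != 0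
    & ideal_set (\sum_(s in 'Gal(E / K)%g) conj_ideal (gal_repr s) I) = content E h].
Proof.
move=> galKE galE; have [f [Ef f0 fE]] := invertible_content (idealGroupP I).
exists (norm_poly K E f); split; [exact: norm_poly_over|exact: norm_poly_neq0|].
suff [] : [/\ norm_poly K E f \is a polyOver E, norm_poly K E f != 0
    & ideal_set (\sum_(s in 'Gal(E / K)%g) conj_ideal (gal_repr s) I)
      = content E (norm_poly K E f)] by [].
apply: (big_ind2 (fun (A : idealGroup E) p =>
  [/\ p \is a polyOver E, p != 0 & ideal_set A = content E p])).
- split; rewrite ?rpred1 ?oner_neq0// ideal_group0E eqEsubset; split.
    move=> x Ox; rewrite -[x]mulr1; case: (content_submodule E 1) => _ _; apply=> //.
    by have := content_coef E 1 0; rewrite coef1.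
  apply: content_min => [|i]; first exact: integer_submodule_O.
  rewrite coef1; case: (_ == _); [exact: ring_of_integers1|exact: ring_of_integers0].
- move=> A p B q [Ep p0 AE] [Eq q0 BE]; split; [exact: rpredM|exact: mulf_neq0|].
  rewrite ideal_groupDE AE BE content_mul//; apply: content_invertible => //.
    exact: rpredM.
  exact: mulf_neq0.
move=> s _; split; [exact: map_poly_gal_over|by rewrite map_poly_eq0|].
by rewrite conj_idealE ?limg_gal// fE image_content ?limg_gal.
Qed.

End Action.

(** * Residue rings *)

Section ResidueBasis.
Variable M : fieldExtType rat.
Implicit Types (K : {subfield M}) (A B : set M) (x y : M) (s : seq M).
Local Notation O := (@ring_of_integers M).

(** The second equation makes the relation primitive: no prime number divides all
    its coefficients. *)
Lemma integer_dependence s : (\dim {:M} < size s)%N ->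
  exists z c : nat -> int, \sum_(i < size s) (z i)%:~R * s`_i = 0 /\
    \sum_(i < size s) c i * z i = 1.
Proof.
move=> ss; have fs : ~~ free s.
  apply: contraL ss => fs; rewrite -leqNgt -(eqP fs).
  by apply/dimvS/subvf.
have [k [ks [i0 ki0]]] : exists k : 'I_(size s) -> rat,
    \sum_i k i *: s`_i = 0 /\ exists i, k i != 0.
  apply: contrapT => nk; move/negP: fs; apply.
  rewrite -[s]/(tval (in_tuple s)); apply/freeP => k ks i; apply: contrapT => /eqP ki.
  by apply: nk; exists k; split=> //; exists i.
pose D := \prod_i denq (k i).
have D0 : D != 0 by apply/prodf_neq0 => i _; apply: denq_neq0.
have /boolp.choice[w wE] i : exists w : int, D%:~R * k i = w%:~R.
  rewrite /D (bigD1 i)//= rmorphM /= mulrAC [_ * k i]mulrC -numqE -rmorphM /=.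
  by eexists.
pose w' j := if insub j is Some i then w i else 0.
have w'E (i : 'I_(size s)) : w' i = w i.
  by rewrite /w' -[nat_of_ord i]/(val i) valK.
have [g [gw [c gE]]] := int_ideal_gcd (mkseq w' (size s)).
have {}gw (i : 'I_(size s)) : (g %| w i)%Z by have := gw i; rewrite nth_mkseq// w'E.
have g0 : g != 0.
  apply: contraNneq ki0 => g0; have := gw i0; rewrite g0 dvd0z => /eqP wi0.
  have := wE i0; rewrite wi0 => /eqP; rewrite mulf_eq0 intr_eq0 (negPf D0).
  by [].
exists (fun i => w' i %/ g)%Z, c; split.
  have gM : g%:~R != 0 :> M by rewrite intr_field_eq0.
  apply: (mulfI gM); rewrite mulr0 mulr_sumr.
  transitivity (D%:~R *: \sum_i k i *: s`_i); last by rewrite ks scaler0.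
  rewrite scaler_sumr; apply: eq_bigr => i _.
  rewrite scalerA wE scaler_int -[RHS]mulrzl mulrA -rmorphM /= mulrC.
  by rewrite [g * _]mulrC w'E divzK// mulrC.
apply: (mulfI g0); rewrite mulr1 [RHS]gE size_mkseq mulr_sumr.
by apply: eq_bigr => i _; rewrite nth_mkseq// mulrCA [g * _]mulrC w'E divzK.
Qed.

Section Basis.
Variables (K : {subfield M}) (p : nat) (A B : set M).
Hypotheses (p_pr : prime p) (subA : integer_submodule K A)
  (subB : integer_submodule K B) (pA : forall x, A x -> B (p%:R * x)).

Let indep s := forall z : nat -> int,
  B (\sum_(i < size s) (z i)%:~R * s`_i) -> forall i : 'I_(size s), (p %| z i)%Z.

(** A basis of A/B over the field with [p] elements.  A family that is independent
    modulo [B] has at most [M : Q] members, because a primitive integral relation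
    is nontrivial modulo [p]; a maximal one spans. *)
Lemma residue_basis : exists s, [/\ forall i, A s`_i,
    forall z : nat -> int, B (\sum_(i < size s) (z i)%:~R * s`_i) ->
      forall i : 'I_(size s), (p %| z i)%Z
  & forall x, A x -> exists z : nat -> nat, (forall i, (z i < p)%N) /\
      B (x - \sum_(i < size s) (z i)%:R * s`_i)].
Proof.
have [A0 _ AM] := subA; have [B0 BD BM] := subB.
have AZ (z : int) x : A x -> A (z%:~R * x).
  by apply/AM/ring_of_integers_int.
have BZ (z : int) x : B x -> B (z%:~R * x).
  by apply/BM/ring_of_integers_int.
pose P m := `[< exists s, [/\ forall i, A s`_i, indep s & size s = m] >].
have P0 : exists m, P m.
  by exists 0%N; apply/asboolP; exists [::]; split=> [i|z _ []|]; rewrite ?nth_nil.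
have Pmax m : P m -> (m <= \dim {:M})%N.
  move=> /asboolP[s [_ inds <-]]; rewrite leqNgt; apply/negP.
  move=> /integer_dependence[z [c [zs cz]]].
  have zp : forall i : 'I_(size s), (p %| z i)%Z by apply: inds; rewrite zs.
  have : (p %| 1%R)%Z.
    by rewrite -cz; apply: rpred_sum => i _; apply: dvdz_mull.
  by rewrite dvdz1 /= => /eqP p1; move: p_pr; rewrite p1.
case: (ex_maxnP P0 Pmax) => m /asboolP[s [As inds sm]] mmax.
exists s; split=> [//|z Bz i|x Ax]; first exact: inds z Bz i.
have [z Bz [i pzi]] : exists2 z : nat -> int,
    B (\sum_(i < (size s).+1) (z i)%:~R * (rcons s x)`_i)
    & exists i : 'I_(size s).+1, ~~ (p %| z i)%Z.
  apply: contrapT => nz; have : P m.+1.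
    apply/asboolP; exists (rcons s x); rewrite size_rcons sm; split=> //.
      by move=> i; rewrite nth_rcons; do !case: ifP => _.
    rewrite /indep size_rcons => z Bz i; apply: contrapT => /negP pzi.
    by apply: nz; exists z => //; exists i.
  by move=> /mmax; rewrite ltnn.
pose S := \sum_(i < size s) (z i)%:~R * s`_i.
have {}Bz : B (S + (z (size s))%:~R * x).
  move: Bz; rewrite big_ord_recr /= nth_rcons ltnn eqxx.
  by rewrite (eq_bigr (fun i : 'I__ => (z i)%:~R * s`_i)) // => j _; rewrite nth_rcons ltn_ord.
have {i}pzi : ~~ (p %| z (size s))%Z.
  apply/negP => pz; case/negP: pzi; have [ilt|] := ltnP i (size s); last first.
    by move=> ige; have -> : i = size s :> nat by apply/eqP; rewrite eqn_leq ige -ltnS ltn_ord.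
  apply: (inds z _ (Ordinal ilt)) => //.
  have -> : \sum_(i < size s) (z i)%:~R * s`_i = S + (z (size s))%:~R * x - (z (size s))%:~R * x.
    by rewrite addrK.
  apply: (submoduleB subB) => //; have /dvdzP[q ->] := pz.
  by rewrite rmorphM /= -mulrA; apply/BZ/pA.
have [u [v uv]] : exists u v : int, u * z (size s) + v * p = 1.
  have [u [v uv]] := Bezoutz (z (size s)) p; exists u, v; rewrite uv.
  apply/eqP; rewrite -[_ == _]/(coprimez _ _) coprimez_sym.
  by rewrite coprimezE /= prime_coprime.
pose c i := (- u * z i)%R.
have p0 : (p : int) != 0 by case: (p) p_pr.
exists (fun i => `|c i %% p|%Z%N); split.
  move=> i; rewrite -ltz_nat gez0_abs ?modz_ge0//.
  by rewrite ltz_mod.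
have -> : x - \sum_(i < size s) (`|(c i %% p)%Z|%N)%:R * s`_i =
    u%:~R * (S + (z (size s))%:~R * x) +
    ((p%:R * (v%:~R * x)) + \sum_(i < size s) (c i %/ p)%Z%:~R * (p%:R * s`_i)).
  have -> : \sum_(i < size s) (`|(c i %% p)%Z|%N)%:R * s`_i =
     - u%:~R * S - \sum_(i < size s) (c i %/ p)%Z%:~R * (p%:R * s`_i).
    rewrite /S mulr_sumr -sumrB; apply: eq_bigr => i _.
    rewrite -[_%:R]/((Posz _)%:~R) gez0_abs ?modz_ge0//.
    rewrite [in LHS]/modz /c !(rmorphB, rmorphM, rmorphN) /=.
    by rewrite -[p%:R]/((Posz p)%:~R); ring.
  have xE : x = u%:~R * ((z (size s))%:~R * x) + p%:R * (v%:~R * x).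
    have := congr1 (intr : int -> M) uv; rewrite rmorphD !rmorphM /= => uvM.
    rewrite mulrA [p%:R * _]mulrA -mulrDl (_ : _ + _ = 1) ?mul1r//.
    by rewrite [p%:R * _]mulrC; exact: uvM.
  by rewrite {1}xE; ring.
apply: (BD); first exact: BZ.
apply: BD; first exact/pA/AZ.
by apply: (submodule_sum subB) => i _; apply/BZ/pA.
Qed.

End Basis.
End ResidueBasis.

(** * Maximal ideals *)

Section MaximalIdeals.
Variable M : splittingFieldType rat.
Implicit Types (K : {subfield M}) (I J P Q : set M) (x y : M).
Local Notation O := (@ring_of_integers M).

Section OneField.
Variables (K : {subfield M}) (P : set M) (maxP : maximal_ideal K P).

Lemma maximal_submodule : integer_submodule K P.
Proof. by case: maxP => -[]. Qed.

Lemma maximal_sub : P `<=` O K.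
Proof. by case: maxP => -[]. Qed.

Lemma maximal_proper : ~ P 1.
Proof.
move=> P1; have [_ PO _] := maxP; apply: PO; rewrite eqEsubset; split.
  exact: maximal_sub.
move=> x Ox; rewrite -[x]mulr1; case: maximal_submodule => _ _; exact.
Qed.

Lemma maximal_comax x : O K x -> ~ P x ->
  exists u v, [/\ P u, O K v & 1 = u + v * x].
Proof.
move=> Ox nPx; have [[PO [P0 PD PM]] _ Pmax] := maxP.
pose J := [set z | exists u v, [/\ P u, O K v & z = u + v * x]].
have O0 := ring_of_integers0 K; have O1 := ring_of_integers1 K.
have intJ : integral_ideal K J.
  split=> [_ [u [v [Pu Ov ->]]]|].
    by apply: ring_of_integersD; [exact: PO|exact: ring_of_integersM].
  split.
  - by exists 0, 0; rewrite mul0r addr0.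
  - move=> _ _ [u [v [Pu Ov ->]]] [s [t [Ps Ot ->]]]; exists (u + s), (v + t).
    by split; [exact: PD|exact: ring_of_integersD|rewrite mulrDl addrACA].
  - move=> a _ Oa [u [v [Pu Ov ->]]]; exists (a * u), (a * v).
    by split; [exact: PM|exact: ring_of_integersM|rewrite mulrDr mulrA].
case: (Pmax J intJ) => [u Pu|JP|JO]; last by have : J 1 by rewrite JO.
  by exists u, 0; split=> //; rewrite mul0r addr0.
by case: nPx; rewrite -JP; exists 0, 1; rewrite mul1r add0r.
Qed.

Lemma maximal_prime x y : O K x -> O K y -> P (x * y) -> P x \/ P y.
Proof.
move=> Ox Oy Pxy; apply: or_asboolP; apply: contrapT => /negP.
rewrite negb_or => /andP[/asboolPn nPx /asboolPn nPy]; apply: nPy.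
have [u [v [Pu Ov uv]]] := maximal_comax Ox nPx.
have [_ PD PM] := maximal_submodule.
rewrite -[y]mulr1 uv mulrDr; apply: PD; first exact: PM.
by rewrite [y * _]mulrC -mulrA; apply: PM.
Qed.

(** Otherwise the ring of integers would be a field, and 1/2 would be an algebraic
    integer. *)
Lemma maximal_neq0 : exists2 x, P x & x != 0.
Proof.
apply: contrapT => nz; have P0 x : P x -> x = 0.
  by move=> Px; apply: contrapT => /eqP x0; apply: nz; exists x.
have O2 : O K 2%:R by exact: (ring_of_integers_int K (Posz 2)).
have [] := @maximal_comax 2%:R => //.
  by move/P0/eqP; rewrite natr_field_eq0.
move=> u [v [/P0-> Ov]]; rewrite add0r => v2.
have /ring_of_integersP[_ iv] := Ov.
have v1 : v \in 1%VS.
  have -> : v = (2%:R : M)^-1.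
    by apply: (mulIf (x := 2%:R)); rewrite ?natr_field_eq0// mulVf ?natr_field_eq0.
  by rewrite rpredV rpred_nat.
have [z zE] := rational_integral v1 iv.
have : (z * 2 == 1)%R.
  rewrite -subr_eq0 -(intr_field_eq0 M) rmorphB rmorphM /= -zE.
  by rewrite subr_eq0; apply/eqP; exact: esym v2.
by lia.
Qed.

(** [P] contains the norm of each of its elements, so it contains a positive
    integer, hence one of its prime factors. *)
Lemma maximal_rational_prime : galois 1 K -> exists2 p, prime p & P p%:R.
Proof.
move=> galK; have [x Px x0] := maximal_neq0.
have Ox := maximal_sub Px.
have [_ _ PM] := maximal_submodule.
have /ring_of_integersP[Kx ix] := Ox.
have PN : P (galNorm 1 K x).
  rewrite /galNorm (bigD1 1%g)//= gal_id mulrC; apply: PM => //.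
  apply/ring_of_integersP; split.
    by apply: rpred_prod => s _; apply: memv_gal.
  by apply: rpred_prod => s _; apply: AEnd_algint.
have N0 : galNorm 1 K x != 0 by rewrite galNorm_eq0.
have [z zE] : exists z : int, galNorm 1 K x = z%:~R.
  apply: rational_integral; first exact: mem_galNorm.
  by have /maximal_sub/ring_of_integersP[] := PN.
have [m m0 Pm] : exists2 m, (0 < m)%N & P m%:R.
  exists `|z|%N; first by move: N0; rewrite zE intr_field_eq0 absz_gt0.
  rewrite -[_%:R]/((Posz `|z|%N)%:~R) abszE; case: (Num.Theory.ger0P z) => _.
    by rewrite -zE.
  by rewrite rmorphN /= -zE; apply: submoduleN PN; exact: maximal_submodule.
elim/ltn_ind: m m0 Pm => m IHm m0 Pm.
have [m1|m1] := leqP m 1.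
  by have m1' : m = 1%N by [move: m1 m0; clear; lia]; move: Pm; rewrite m1' => /maximal_proper.
have p_pr := pdiv_prime m1; set p := pdiv m in p_pr.
have pm : (p %| m)%N by apply: pdiv_dvd.
have [|||Pp|Pmp] := @maximal_prime p%:R (m %/ p)%:R.
- exact: ring_of_integers_int K p.
- exact: ring_of_integers_int K (m %/ p)%N.
- by rewrite -natrM mulnC divnK.
- by exists p.
apply: (IHm (m %/ p)%N) => //; first by rewrite ltn_Pdiv// prime_gt1.
by rewrite divn_gt0 ?prime_gt0// dvdn_leq.
Qed.

Section OverPrime.
Variables (p : nat) (p_pr : prime p) (Pp : P p%:R).

Lemma maximal_int (z : int) : P z%:~R -> (p %| z)%Z.
Proof.
move=> Pz; apply: contrapT => /negP pz; apply: maximal_proper.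
have [u [v uv]] : exists u v : int, u * z + v * p = 1.
  have [u [v uv]] := Bezoutz z p; exists u, v; rewrite uv.
  apply/eqP; rewrite -[_ == _]/(coprimez _ _) coprimez_sym.
  by rewrite coprimezE /= prime_coprime.
have [_ PD PM] := maximal_submodule.
have := congr1 (intr : int -> M) uv; rewrite rmorphD !rmorphM /= => uvM.
rewrite -[1]/((1 : int)%:~R) -uvM.
by apply: PD; (apply: PM; first exact: ring_of_integers_int).
Qed.

(** [P] is generated by [p] and lifts of a basis of P modulo p times the ring of
    integers. *)
Lemma maximal_content :
  exists f, [/\ f \is a polyOver K, f != 0 & P = content K f].
Proof.
have [P0 PD PM] := maximal_submodule.
have Kp : p%:R \in K by apply: rpred_nat.
have subB := integer_submodule_principal K p%:R.
have [|s [Ps _ sP]] := residue_basis p_pr maximal_submodule subB.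
  by move=> x /maximal_sub Ox; exists x.
pose f := Poly (p%:R :: s).
have fE i : f`_i = (p%:R :: s)`_i by rewrite coef_Poly.
have Pf i : P f`_i by rewrite fE; case: i.
have PE : P = content K f.
  rewrite eqEsubset; split; last exact: content_min maximal_submodule Pf.
  case: (content_submodule K f) => C0 CD CM.
  move=> x Px; have [z [_ [y Oy yE]]] := sP x Px.
  rewrite -[x](subrK (\sum_(i < size s) (z i)%:R * s`_i)) -yE; apply: CD.
    by rewrite mulrC; apply: CM => //; have := content_coef K f 0; rewrite fE.
  apply: (submodule_sum (content_submodule K f)) => i _; apply: CM.
    exact: ring_of_integers_int K (z i).
  by have := content_coef K f i.+1; rewrite fE.
exists f; split=> //.
  by apply/polyOverP => i; have /maximal_sub/ring_of_integersP[] := Pf i.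
apply/eqP => f0; have := fE 0%N; rewrite f0 coef0 => /esym/eqP.
by rewrite /= natr_field_eq0 => /eqP p0; move: p_pr; rewrite p0.
Qed.

(** The residue field is a nonzero vector space over the field with [p]
    elements.  That the norm is a power of [p] is what makes [p] a function of the
    norm. *)
Lemma maximal_norm : exists2 k, (0 < k)%N & has_norm K P (p ^ k).
Proof.
have [P0 PD PM] := maximal_submodule.
have subO := integer_submodule_O K.
have [|s [Os inds sO]] := residue_basis p_pr subO maximal_submodule.
  by move=> x Ox; rewrite mulrC; apply: PM.
pose rep (c : {ffun 'I_(size s) -> 'I_p}) := \sum_(i < size s) (c i)%:R * s`_i.
have repO c : O K (rep c).
  apply: (submodule_sum subO) => i _; apply: ring_of_integersM => //.
  exact: ring_of_integers_int K (c i).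
pose coset x := [set x + y | y in P].
have cosetP x y : P (x - y) -> coset x = coset y.
  move=> Pxy; rewrite eqEsubset; split=> _ [z Pz <-].
    by exists (x - y + z); [exact: PD|rewrite addrA addrC subrKC addrC].
  exists (y - x + z); last by rewrite addrA subrKC.
  by apply: PD => //; rewrite -opprB; apply: submoduleN maximal_submodule _ _.
have coset_inj : injective (coset \o rep).
  move=> c d /= cd; have [y Py] : coset (rep c) (rep d).
    by rewrite cd; exists 0; rewrite ?addr0.
  move=> /(canRL (addKr _)); rewrite addrC => yE.
  apply/ffunP => i; apply/val_inj => /=.
  have : (p %| (d i)%:Z - (c i)%:Z)%Z.
    pose z j := if insub j is Some l then (d l)%:Z - (c l)%:Z else 0 : int.
    have zE (l : 'I_(size s)) : z l = (d l)%:Z - (c l)%:Z.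
      by rewrite /z -[nat_of_ord l]/(val l) valK.
    rewrite -zE; apply: inds.
    have -> : \sum_(l < size s) (z l)%:~R * s`_l = y.
      rewrite yE -sumrB; apply: eq_bigr => l _.
      by rewrite zE rmorphB mulrBl.
    by [].
  have := ltn_ord (c i); have := ltn_ord (d i).
  move: (nat_of_ord (c i)) (nat_of_ord (d i)) => a b bp ap.
  rewrite -eqz_mod_dvd => /eqP; rewrite !modz_small; last 2 first.
  - by rewrite /= ltz_nat.
  - by rewrite /= ltz_nat.
  by move=> -[->].
exists (size s).
  rewrite lt0n; apply/eqP => s0; have [z [_]] := sO 1 (ring_of_integers1 K).
  by rewrite big1 ?subr0 => [/maximal_proper//|i]; have := ltn_ord i; rewrite {2}s0.
rewrite /has_norm.
have -> : [set coset x | x in O K] = (coset \o rep) @` setT.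
  rewrite eqEsubset; split=> [_ [x Ox <-]|_ [c _ <-]]; last by exists (rep c).
  have [z [zp Pz]] := sO x Ox; exists [ffun i : 'I_(size s) => Ordinal (zp i)] => //=.
  apply/esym/cosetP; rewrite /rep; congr P: Pz; congr (_ - _).
  by apply: eq_bigr => i _; rewrite ffunE.
apply: card_eq_trans (inj_card_eq _) _; first by move=> c d _ _; apply: coset_inj.
have -> : (p ^ size s)%N = #|{ffun 'I_(size s) -> 'I_p}|.
  by rewrite card_ffun !card_ord.
apply: card_eq_trans (card_esym card_II).
apply: card_esym; have -> : [set: 'I_#|{ffun 'I_(size s) -> 'I_p}|] = enum_rank @` setT.
  rewrite eqEsubset; split=> // i _; exists (enum_val i) => //; exact: enum_valK.
by apply: inj_card_eq => c d _ _; apply: enum_rank_inj.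
Qed.

End OverPrime.
End OneField.
End MaximalIdeals.

(** * Divisibility and absolute norms of ideals *)

Section InvariantIdeals.
Variable M : splittingFieldType rat.
Local Notation O := (@ring_of_integers M).

Lemma ideal_mulSl (I I' J : set M) : I `<=` I' -> ideal_mul I J `<=` ideal_mul I' J.
Proof.
move=> II'; apply: ideal_mul_min; do ?[exact: ideal_mul0|exact: ideal_mulD].
by move=> x y /II'; apply: ideal_mul_incl.
Qed.

Section IdealGroupOrder.
Variable K : {subfield M}.
Implicit Types I J : idealGroup K.

Definition integral_idealg I := ideal_set I `<=` O K.

Lemma idealg_submodule I : integer_submodule K I.
Proof. by have [[]] := idealGroupP I. Qed.

Lemma integral_idealgD I J :
  integral_idealg I -> integral_idealg J -> integral_idealg (I + J).
Proof.
move=> IO JO; have [O0 OD OM] := integer_submodule_O K.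
by rewrite /integral_idealg ideal_groupDE; apply: ideal_mul_min => // x y /IO Ox /JO; apply: OM.
Qed.

Lemma integral_idealg_sum (T : Type) (r : seq T) (P : pred T)
    (F : T -> idealGroup K) :
  (forall i, P i -> integral_idealg (F i)) -> integral_idealg (\sum_(i <- r | P i) F i).
Proof. by move=> FO; apply: big_ind => //; exact: integral_idealgD. Qed.

(** To contain is to divide. *)
Lemma idealg_subP I J :
  ideal_set I `<=` ideal_set J <-> integral_idealg (I - J).
Proof.
split=> [IJ|IJ].
  rewrite /integral_idealg -(ideal_group0E K) -(subrr J) !ideal_groupDE.
  exact: ideal_mulSl.
rewrite -[I](subrK J) -[in X in _ `<=` X](ideal_mul1 (idealg_submodule J)) ideal_groupDE.
exact: ideal_mulSl.
Qed.

Lemma idealg_subr I J : integral_idealg J -> ideal_set (I + J) `<=` ideal_set I.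
Proof. by move=> JO; apply/idealg_subP; rewrite addrC addKr. Qed.

Lemma maximal_prime_sum (P : set M) (T : eqType) (r : seq T) (F : T -> idealGroup K) :
    maximal_ideal K P -> (forall i, i \in r -> integral_idealg (F i)) ->
    ideal_set (\sum_(i <- r) F i) `<=` P ->
  exists2 i, i \in r & ideal_set (F i) `<=` P.
Proof.
move=> maxP; elim: r => [|a r IHr] FO.
  rewrite big_nil => OP; case: (maximal_proper maxP).
  exact/OP/ring_of_integers1.
rewrite big_cons ideal_groupDE => FP.
have [aP|/existsNP[x /not_implyP[Fx nPx]]] := pselect (ideal_set (F a) `<=` P).
  by exists a; rewrite ?mem_head.
have [||i ir iP] := IHr; last by exists i; rewrite // inE ir orbT.
  by move=> i ir; apply: FO; rewrite inE ir orbT.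
move=> y Fy; have Oy : O K y.
  apply: (@integral_idealg_sum _ r (mem r) F) => [i ir|]; last by rewrite -big_seq.
  by apply: FO; rewrite inE; apply/orP; right.
have Ox : O K x by apply: (FO a); rewrite ?mem_head.
by have [] := maximal_prime maxP Ox Oy (FP _ (ideal_mul_incl Fx Fy)).
Qed.

End IdealGroupOrder.

Section Galois.
Variables (K : {subfield M}) (galK : galois 1 K).
Implicit Types (I J : idealGroup K) (phi : 'AEnd(M)).

Lemma conjE phi I : ideal_set (conj_ideal phi I) = phi @` ideal_set I.
Proof. by rewrite conj_idealE//; apply: galois_img. Qed.

Lemma conjD phi I J :
  conj_ideal phi (I + J) = conj_ideal phi I + conj_ideal phi J.
Proof.
by apply: val_inj; rewrite /= conjE !ideal_groupDE image_ideal_mul !conjE.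
Qed.

Lemma conjB phi I J :
  conj_ideal phi (I - J) = conj_ideal phi I - conj_ideal phi J.
Proof. by apply/eqP; rewrite eq_sym subr_eq -conjD subrK. Qed.

Lemma conj0 phi : conj_ideal phi (0 : idealGroup K) = 0.
Proof. by have := conjB phi 0 0; rewrite !subrr. Qed.

Lemma conj_sum phi (T : Type) (r : seq T) (P : pred T) (F : T -> idealGroup K) :
  conj_ideal phi (\sum_(i <- r | P i) F i) = \sum_(i <- r | P i) conj_ideal phi (F i).
Proof. exact: (big_morph _ (conjD phi) (conj0 phi)). Qed.

Lemma conjK phi : cancel (@conj_ideal M K phi) (@conj_ideal M K (phi^-1)%AF).
Proof.
move=> I; apply: val_inj; rewrite /= !conjE image_comp.
by apply: eq_image_id => x _ /=; rewrite lker0_lfunK ?AEnd_lker0.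
Qed.

Lemma conjVK phi : cancel (@conj_ideal M K (phi^-1)%AF) (@conj_ideal M K phi).
Proof.
move=> I; apply: val_inj; rewrite /= !conjE image_comp.
by apply: eq_image_id => x _ /=; rewrite lker0_lfunVK ?AEnd_lker0.
Qed.

Lemma integral_conj phi I : integral_idealg I -> integral_idealg (conj_ideal phi I).
Proof.
move=> IO; rewrite /integral_idealg conjE => _ [x /IO Ox <-].
exact/AEnd_O/Ox/galois_img.
Qed.

Definition abs_norm I : idealGroup K :=
  \sum_(s in 'Gal(K / 1)%g) conj_ideal (gal_repr s) I.

(** The absolute norm is kept as a positive integer, determined by the ideal and
    multiplicative, in order to serve as a measure for induction. *)
Definition is_norm I (m : nat) :=
  (0 < m)%N /\ ideal_set (abs_norm I) = principal_ideal K m%:R.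

Lemma abs_normD I J : abs_norm (I + J) = abs_norm I + abs_norm J.
Proof. by rewrite -big_split; apply: eq_bigr => s _; rewrite conjD. Qed.

Lemma abs_norm_integral I : integral_idealg I -> integral_idealg (abs_norm I).
Proof. by move=> IO; apply: integral_idealg_sum => s _; apply: integral_conj. Qed.

Lemma abs_norm_sub I : integral_idealg I -> ideal_set (abs_norm I) `<=` ideal_set I.
Proof.
move=> IO; rewrite /abs_norm (bigD1 1%g)//=.
have -> : conj_ideal (gal_repr (1%g : gal_of K)) I = I.
  apply: val_inj; rewrite /= conjE; apply: eq_image_id => x _ /=.
  by rewrite gal_id.
apply: idealg_subr; apply: integral_idealg_sum => s _; exact: integral_conj.
Qed.

Lemma is_norm_ex I : integral_idealg I -> exists m, is_norm I m.
Proof.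
move=> IO; have [h [h1 h0 hE]] := norm_idealE I galK galK.
have [d [d1 d0 dE]] := content_rational K h1 h0.
have NE : ideal_set (abs_norm I) = principal_ideal K d by rewrite -dE -hE.
have [z zE] : exists z : int, d = z%:~R.
  apply: rational_integral => //.
  have : O K d.
    apply: (abs_norm_integral IO); rewrite NE; exists 1; rewrite ?mulr1//.
    exact: ring_of_integers1.
  by move/ring_of_integersP => [].
exists `|z|%N; split; first by rewrite absz_gt0 -(intr_field_eq0 M) -zE.
rewrite NE zE -[_%:R]/((Posz `|z|%N)%:~R) abszE.
case: (Num.Theory.ger0P z) => // _; rewrite rmorphN /= eqEsubset.
split=> _ [x Ox <-]; exists (- x); rewrite ?mulrNN ?mulrN ?mulNr//;
  exact: ring_of_integersN.
Qed.

Lemma is_normD I J m n : is_norm I m -> is_norm J n -> is_norm (I + J) (m * n).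
Proof.
move=> [m0 mE] [n0 nE]; split; first by rewrite muln_gt0 m0.
by rewrite abs_normD ideal_groupDE mE nE principal_ideal_mul natrM.
Qed.

Lemma is_norm_uniq I m n : is_norm I m -> is_norm I n -> m = n.
Proof.
suff dv a b : is_norm I a -> is_norm I b -> (a %| b)%N.
  by move=> Im In; apply/eqP; rewrite eqn_dvd !dv.
move=> [a0 aE] [b0 bE]; have : principal_ideal K a%:R b%:R.
  by rewrite -aE bE; exists 1; rewrite ?mulr1//; exact: ring_of_integers1.
move=> [x /ring_of_integersP[_ ix] xE].
have aM : a%:R != 0 :> M by rewrite natr_field_eq0 -lt0n.
have [z zE] : exists z : int, x = z%:~R.
  apply: rational_integral => //; rewrite -(mulKf aM x) xE.
  by rewrite rpredM ?rpredV ?rpred_nat.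
have abz : a%:Z * z = b%:Z by apply: (@intr_field_inj M); rewrite rmorphM /= -zE.
by have : (a %| `|b%:Z|)%N by rewrite -abz abszM dvdn_mulr.
Qed.

Lemma is_norm1 I : integral_idealg I -> is_norm I 1 -> I = 0.
Proof.
move=> IO [_ NI]; apply: val_inj; rewrite eqEsubset; split=> //.
apply: subset_trans (abs_norm_sub IO); rewrite NI principal_ideal1.
exact: subset_refl.
Qed.

Lemma is_norm_gt1 I m : integral_idealg I -> is_norm I m -> I != 0 -> (1 < m)%N.
Proof.
move=> IO Im; rewrite ltnNge; apply: contraNN => m1; apply/eqP/is_norm1 => //.
by have [m0 _] := Im; have -> : 1%N = m by [move: m0 m1; clear; lia].
Qed.

Section Maximal.
Variables (P : set M) (maxP : maximal_ideal K P).

Lemma maximal_invertible : invertible_ideal K P.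
Proof.
have [p p_pr Pp] := maximal_rational_prime maxP galK.
have [f [Kf f0 ->]] := maximal_content maxP p_pr Pp.
exact: content_invertible.
Qed.

Lemma image_maximal phi : maximal_ideal K (phi @` P).
Proof.
have phiK := galois_img phi galK; have phiVK := galois_img (phi^-1)%AF galK.
have [[PO subP] neP Pmax] := maxP; split.
- split; last exact: image_submodule.
  by move=> _ [x /PO Ox <-]; apply: AEnd_O.
- move=> PE; apply: (maximal_proper maxP).
  have : (phi @` P) 1 by rewrite PE; apply: ring_of_integers1.
  by move=> [x Px] /eqP; rewrite fmorph_eq1 => /eqP <-.
move=> J [JO subJ] PJ.
have JE : J = phi @` ((phi^-1)%AF @` J).
  rewrite image_comp eq_image_id// => x _ /=.
  by rewrite lker0_lfunVK ?AEnd_lker0.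
have [||JP|JP] := Pmax ((phi^-1)%AF @` J).
- split; last exact: image_submodule.
  by move=> _ [x /JO Ox <-]; apply: AEnd_O.
- move=> x Px; exists (phi x); first by apply: PJ; exists x.
  by rewrite /= lker0_lfunK ?AEnd_lker0.
- by left; rewrite JE JP.
- by right; rewrite JE JP image_ring_of_integers.
Qed.

Lemma image_has_norm phi q : has_norm K P q -> has_norm K (phi @` P) q.
Proof.
have phiK := galois_img phi galK.
apply: card_eq_trans.
have -> : [set [set x + y | y in phi @` P] | x in O K] =
    (fun X => phi @` X) @` [set [set x + y | y in P] | x in O K].
  rewrite -[in LHS](image_ring_of_integers phiK) !image_comp.
  apply: eq_imagel => x _ /=; rewrite !image_comp.
  by apply: eq_imagel => y _ /=; rewrite rmorphD.
apply: inj_card_eq => X Y _ _ XY.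
have phi_inj := @fmorph_inj _ _ phi.
rewrite eqEsubset; split=> x Xx.
  have : (phi @` Y) (phi x) by rewrite -XY; exists x.
  by move=> [y Yy /phi_inj <-].
have : (phi @` X) (phi x) by rewrite XY; exists x.
by move=> [y Yy /phi_inj <-].
Qed.

Lemma maximal_eq (Q : set M) : maximal_ideal K Q -> P `<=` Q -> Q = P.
Proof.
move=> maxQ PQ; have [intQ neQ _] := maxQ; have [_ _ Pmax] := maxP.
by have [|/neQ] := Pmax Q intQ PQ.
Qed.

End Maximal.

(** The product of the conjugates of [P] is generated by an integer [m] in [P].
    Then [p] divides [m], so [Q] contains this product, and [Q], being prime,
    contains a conjugate of [P]. *)
Lemma maximal_transitive (P Q : idealGroup K) p :
    maximal_ideal K P -> maximal_ideal K Q -> prime p ->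
    ideal_set P p%:R -> ideal_set Q p%:R ->
  exists s : gal_of K, Q = conj_ideal (gal_repr s) P.
Proof.
move=> maxP maxQ p_pr Pp Qp.
have PO : integral_idealg P := maximal_sub maxP.
have [m [m0 mE]] := is_norm_ex PO.
have [_ _ QM] := maximal_submodule maxQ.
have Qm : ideal_set Q m%:R.
  have : ideal_set P m%:R.
    apply: (abs_norm_sub PO); rewrite mE; exists 1; rewrite ?mulr1//.
    exact: ring_of_integers1.
  move=> /(@maximal_int _ _ _ maxP p p_pr Pp m)/dvdzP[z mz].
  have /= -> : m%:R = (m%:Z)%:~R :> M by [].
  rewrite mz rmorphM; apply: QM => //; exact: ring_of_integers_int.
have NQ : ideal_set (abs_norm P) `<=` ideal_set Q.
  by rewrite mE => _ [x Ox <-]; rewrite mulrC; apply: QM.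
move: NQ; rewrite /abs_norm -big_enum /= => NQ.
have [s _|s _ sQ] := maximal_prime_sum maxQ _ NQ; first exact: integral_conj.
exists s; apply: val_inj => /=; apply: maximal_eq sQ => //.
by rewrite conjE; apply: image_maximal.
Qed.

(** Take a proper ideal [P] containing [I] of least absolute norm.  A larger
    submodule need not be known to be invertible, but [P] and one more element
    generate an invertible ideal, of smaller norm unless it is everything. *)
Lemma exists_maximal I : integral_idealg I -> I != 0 ->
  exists P : idealGroup K, maximal_ideal K P /\ ideal_set I `<=` ideal_set P.
Proof.
move=> IO I0.
pose T m := `[< exists J : idealGroup K,
  [/\ integral_idealg J, J != 0, ideal_set I `<=` ideal_set J & is_norm J m] >].
have T0 : exists m, T m.
  by have [m Im] := is_norm_ex IO; exists m; apply/asboolP; exists I; split.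
case: (ex_minnP T0) => m /asboolP[P [PO P0 IP Pm]] mmin; exists P; split=> //.
have subP := idealg_submodule P; split; first by split.
  move=> PE; move/eqP: P0; apply; apply: val_inj; exact: PE.
move=> J [JO subJ] PJ.
have [JP|] := pselect (J `<=` ideal_set P).
  by left; rewrite eqEsubset.
move=> /existsNP[x /not_implyP[Jx nPx]]; right.
have [f [Kf f0 PE]] := invertible_content (idealGroupP P).
pose g := Poly (x :: f).
have gE i : g`_i = (x :: f)`_i by rewrite coef_Poly.
have Jg i : J g`_i.
  by rewrite gE; case: i => [|i] //=; apply: PJ; rewrite PE; apply: content_coef.
have Kg : g \is a polyOver K.
  by apply/polyOverP => i; have /JO/ring_of_integersP[] := Jg i.
have g0 : g != 0.
  apply: contraNneq f0 => g0; apply/eqP/polyP => i.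
  by have := gE i.+1; rewrite g0 !coef0.
pose P2 := IdealGroup (asboolT (content_invertible galK Kg g0)).
have P2O : integral_idealg P2.
  by apply: content_min => [|i]; [exact: integer_submodule_O|exact: JO].
have PP2 : ideal_set P `<=` ideal_set P2.
  rewrite PE; apply: content_min => [|i]; first exact: content_submodule.
  by have := content_coef K g i.+1; rewrite gE.
have [P20|P20] := eqVneq P2 0.
  rewrite eqEsubset; split=> //; rewrite -(ideal_group0E K) -P20.
  exact: content_min.
have [n P2n] := is_norm_ex P2O.
have mn : (m <= n)%N.
  by apply: mmin; apply/asboolP; exists P2; split=> //; apply: subset_trans PP2.
have DO : integral_idealg (P - P2) by apply/idealg_subP.
have [l Dl] := is_norm_ex DO.
have mE : m = (l * n)%N.
  by apply: (is_norm_uniq Pm); rewrite -[P](subrK P2); apply: is_normD.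
have D0 : P - P2 != 0.
  apply: contra_notN nPx; rewrite subr_eq0 => /eqP ->.
  by have := content_coef K g 0; rewrite gE.
have l1 := is_norm_gt1 DO Dl D0; have [n0 _] := P2n.
by move: mE l1 n0 mn; clear; nia.
Qed.

End Galois.
End InvariantIdeals.

(** * The Polya group as the group of classes of invariant ideals *)

Section PolyaInvariant.
Variables (M : splittingFieldType rat) (K : {subfield M}) (galK : galois 1 K).
Implicit Types (I J P Q : idealGroup K) (phi : 'AEnd(M)).
Local Notation O := (@ring_of_integers M).

Definition invariant_ideal I := forall phi, conj_ideal phi I = I.

Lemma invariant_idealB I J :
  invariant_ideal I -> invariant_ideal J -> invariant_ideal (I - J).
Proof. by move=> invI invJ phi; rewrite conjB// invI invJ. Qed.

(** If the set of maximal ideals of norm [q] is infinite, the family is empty; the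
    product is then trivial and still invariant. *)
Lemma Pi_ideal_sum q : exists s : seq (idealGroup K),
  [/\ uniq s, forall P, P \in s -> maximal_ideal K P /\ has_norm K P q,
      Pi_ideal K q = ideal_set (\sum_(P <- s) P),
      invariant_ideal (\sum_(P <- s) P)
    & finite_set [set P : set M | maximal_ideal K P /\ has_norm K P q] ->
      forall P, maximal_ideal K P -> has_norm K P q -> P \in s].
Proof.
set S := [set P | _]; pose r := finite_support (O K) S id.
have SE : S `&` id @^-1` [set~ O K] = S.
  by apply/setIidPl => P [[_ PO _] _].
have [finS rE] : (finite_set S -> forall P : set M, S P -> P \in r) /\ {subset r <= S}.
  have [finS|infS] := pselect (finite_set S); last first.
    by rewrite /r no_finite_support ?SE.
  have rE : r =i S by move=> P; rewrite /r in_finite_support ?SE.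
  by split=> [_ P SP|P]; rewrite rE// inE.
have uniq_r : uniq r by apply: finite_support_uniq.
pose s : seq (idealGroup K) := map (insubd (0 : idealGroup K)) r.
have sK (X : set M) : X \in r -> ideal_set (insubd (0 : idealGroup K) X) = X.
  move=> /rE; rewrite inE => -[maxX _].
  by rewrite -[ideal_set _]/(val _) insubdK//; apply/asboolP/maximal_invertible.
have rsE : map (@ideal_set M K) s = r.
  by rewrite -map_comp map_id_in// => X /sK.
have sr P : (P \in s) = (ideal_set P \in r) by rewrite -rsE mem_map//; exact: val_inj.
have uniq_s : uniq s by apply: (@map_uniq _ _ (@ideal_set M K)); rewrite rsE.
have sS P : P \in s -> S (ideal_set P) by rewrite sr => /rE; rewrite inE.
exists s; split=> //.
- rewrite /Pi_ideal -/S -/r -rsE big_map.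
  by rewrite (big_morph (@ideal_set M K) (ideal_groupDE (K := K)) (ideal_group0E K)).
- move=> phi; rewrite conj_sum// -(big_map _ predT id); apply: perm_big.
  have conj_s psi P : P \in s -> conj_ideal psi P \in s.
    have [fS|infS] := pselect (finite_set S); last first.
      by rewrite sr /r no_finite_support ?SE.
    rewrite !sr => /rE; rewrite inE => -[maxP nP]; apply: finS => //.
    by rewrite conjE//; split; [exact: image_maximal|exact: image_has_norm].
  apply: uniq_perm => //; first by rewrite map_inj_uniq//; exact: can_inj (conjK galK phi).
  move=> P; apply/mapP/idP => [[Q Qs ->]|Ps]; first exact: conj_s.
  by exists (conj_ideal (phi^-1)%AF P); [exact: conj_s|rewrite conjVK].
by move=> fS P maxP nP; rewrite sr; apply: finS.
Qed.

Lemma ideal_class_eq0 I : (ideal_class I == 0) = (I \in principal K).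
Proof.
have -> : 0 = ideal_class (0 : idealGroup K) by rewrite /ideal_class raddf0.
by rewrite /ideal_class -Quotient.idealrBE subr0.
Qed.

Lemma ideal_classB I J : ideal_class (I - J) = ideal_class I - ideal_class J.
Proof. by rewrite /ideal_class raddfB. Qed.

Lemma ideal_classD I J : ideal_class (I + J) = ideal_class I + ideal_class J.
Proof. by rewrite /ideal_class raddfD. Qed.

Lemma polya_Pi q I : (0 < q)%N -> ideal_set I = Pi_ideal K q -> ideal_class I \in polya K.
Proof. by move=> q0 IE; apply/asboolP => H; apply; exists q => //; exists I. Qed.

Definition invariant_classes : {pred classGroup K} :=
  fun c => `[< exists2 I, invariant_ideal I & c = ideal_class I >].

Fact invariant_classes_closed : zmod_closed invariant_classes.
Proof.
split=> [|c d /asboolP[I invI ->] /asboolP[J invJ ->]]; apply/asboolP.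
  exists 0; first by move=> phi; rewrite conj0.
  by apply/esym/eqP; rewrite ideal_class_eq0 rpred0.
by exists (I - J); [exact: invariant_idealB|rewrite ideal_classB].
Qed.

HB.instance Definition _ :=
  GRing.isZmodClosed.Build (classGroup K) invariant_classes invariant_classes_closed.

(** Distinct maximal ideals that divide [I] can be divided out one after the other. *)
Lemma maximal_sub_sum I (s : seq (idealGroup K)) : integral_idealg I -> uniq s ->
    (forall P, P \in s -> maximal_ideal K P /\ ideal_set I `<=` ideal_set P) ->
  ideal_set I `<=` ideal_set (\sum_(P <- s) P).
Proof.
elim: s I => [|P s IHs] I IO; first by rewrite big_nil.
move=> /= /andP[Ps us] sP; have [maxP IP] := sP P (mem_head _ _).
have DO : integral_idealg (I - P) by apply/idealg_subP.
have PO : integral_idealg P := maximal_sub maxP.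
have IE : I = (I - P) + P by rewrite subrK.
rewrite big_cons IE addrC [X in _ `<=` X]ideal_groupDE ideal_groupDE.
rewrite ideal_mulC [X in _ `<=` X]ideal_mulC; apply: ideal_mulSl.
apply: IHs => // Q Qs; have [|maxQ IQ] := sP Q; first by rewrite inE Qs orbT.
split=> //; have : ideal_set (\sum_(A <- [:: I - P; P]) A) `<=` ideal_set Q.
  by rewrite big_cons big_seq1 subrK.
case/(maximal_prime_sum maxQ) => [A|A].
  by rewrite !inE => /orP[/eqP->|/eqP->].
rewrite !inE => /orP[/eqP-> //|/eqP-> PQ].
by move: Ps; rewrite (_ : P = Q) ?Qs//; apply: val_inj; apply/esym/(maximal_eq maxP).
Qed.

(** Induction on the absolute norm.  If [P] is a maximal ideal containing [I], the
    maximal ideals of the same norm are the conjugates of [P], so they all contain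
    the invariant ideal [I], and the quotient of [I] by their product is again
    integral and invariant. *)
Lemma invariant_integral_polya I : integral_idealg I -> invariant_ideal I ->
  ideal_class I \in polya K.
Proof.
move=> IO invI; have [m Im] := is_norm_ex galK IO.
elim/ltn_ind: m I IO invI Im => m IHm I IO invI Im.
have [->|I0] := eqVneq I 0.
  have /eqP -> : ideal_class (0 : idealGroup K) == 0 by rewrite ideal_class_eq0 rpred0.
  exact: rpred0.
have [P [maxP IP]] := exists_maximal galK IO I0.
have [p p_pr Pp] := maximal_rational_prime maxP galK.
have [k k0 Pk] := maximal_norm maxP p_pr Pp.
have orbitP (Q : set M) : maximal_ideal K Q -> has_norm K Q (p ^ k) ->
    exists s : gal_of K, Q = gal_repr s @` ideal_set P.
  move=> maxQ Qk; have [p' p'_pr Qp'] := maximal_rational_prime maxQ galK.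
  have [k' k'0 Qk'] := maximal_norm maxQ p'_pr Qp'.
  have pp' : p = p'.
    have pk : (p ^ k = p' ^ k')%N.
      by apply/card_eq_II; apply: card_eq_trans Qk'; apply: card_esym.
    have : (p %| p' ^ k')%N by rewrite -pk dvdn_exp.
    by rewrite Euclid_dvdX// k'0 andbT dvdn_prime2// => /eqP.
  pose Q' := IdealGroup (asboolT (maximal_invertible galK maxQ)).
  have [|s QE] := @maximal_transitive _ _ galK P Q' p maxP maxQ p_pr Pp.
    by rewrite pp'.
  by exists s; rewrite -conjE// -QE.
have [s [us sS PiE invS Ss]] := Pi_ideal_sum (p ^ k).
have finS : finite_set [set Q : set M | maximal_ideal K Q /\ has_norm K Q (p ^ k)].
  apply: (@sub_finite_set _ _ ((fun s : gal_of K => gal_repr s @` ideal_set P) @` setT)).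
    by move=> Q [maxQ /(orbitP _ maxQ)[sig ->]]; exists sig.
  exact/finite_image/finite_finset.
pose S := \sum_(Q <- s) Q.
have SO : integral_idealg S.
  rewrite /S big_seq; apply: integral_idealg_sum => Q /sS[maxQ _]; exact: maximal_sub.
have IS : ideal_set I `<=` ideal_set S.
  apply: maximal_sub_sum => // Q Qs; have [maxQ Qk] := sS Q Qs; split=> //.
  have [phi ->] := orbitP Q maxQ Qk.
  by rewrite -{1}(invI phi) conjE//; apply: image_subset.
have SP : ideal_set S `<=` ideal_set P.
  rewrite /S (big_rem P) ?Ss//=; apply: idealg_subr.
  rewrite big_seq; apply: integral_idealg_sum => Q /mem_rem/sS[maxQ _].
  exact: maximal_sub.
have S0 : S != 0.
  apply/eqP => S0; apply: (maximal_proper maxP); apply: SP.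
  by rewrite S0; apply: ring_of_integers1.
have [n Sn] := is_norm_ex galK SO; have n1 := is_norm_gt1 galK SO Sn S0.
have DO : integral_idealg (I - S) by apply/idealg_subP.
have [l Dl] := is_norm_ex galK DO.
have mE : m = (l * n)%N.
  by apply: (is_norm_uniq Im); rewrite -[I](subrK S); apply: is_normD.
rewrite -[I](subrK S) ideal_classD; apply: rpredD; last first.
  by apply: (polya_Pi (q := p ^ k)); rewrite ?expn_gt0 ?prime_gt0.
apply: (IHm l) => //; last exact: invariant_idealB.
by have [l0 _] := Dl; rewrite mE ltn_Pmulr.
Qed.

Lemma conj_principal phi I a : a \in 1%VS -> ideal_set I = principal_ideal K a ->
  conj_ideal phi I = I.
Proof.
move=> /vlineP[k ->] IE; apply: val_inj; rewrite /= conjE// IE image_principal.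
  by rewrite linearZ rmorph1.
exact: galois_img.
Qed.

(** An arbitrary invariant ideal is made integral by a rational number, namely the
    norm of a denominator, which keeps it invariant and does not change its
    class. *)
Lemma polyaP c : c \in polya K <-> exists2 I, invariant_ideal I & c = ideal_class I.
Proof.
split=> [/asboolP/(_ invariant_classes)|[I invI ->]].
  move=> cI; apply/asboolP; apply: cI => _ [q q0 [I IE ->]]; apply/asboolP.
  exists I => //; have [s [_ _ PiE invS _]] := Pi_ideal_sum q.
  by have -> : I = \sum_(P <- s) P by apply: val_inj; rewrite /= IE PiE.
have [[IK subI [d [Od d0 dI]]] _] := idealGroupP I.
have /ring_of_integersP[Kd id] := Od.
pose a := galNorm 1 K d; pose b := \prod_(s in 'Gal(K / 1)%g | s != 1%g) (gal_repr s) d.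
have aE : a = b * d by rewrite /a /galNorm (bigD1 1%g)//= gal_id mulrC.
have a1 : a \in 1%VS by apply: mem_galNorm.
have a0 : a != 0 by rewrite galNorm_eq0.
have Ob : O K b.
  apply/ring_of_integersP; split; apply: rpred_prod => s _.
    exact: memv_gal.
  exact: AEnd_algint.
have Ka : a \in K by apply: (subvP (sub1v K)).
pose A := IdealGroup (asboolT (invertible_principal Ka a0)).
have AO : integral_idealg (A + I).
  have [O0 OD OM] := integer_submodule_O K.
  rewrite /integral_idealg ideal_groupDE; apply: ideal_mul_min => // _ y [x Ox <-] Iy.
  have -> : a * x * y = x * (b * (d * y)) by rewrite aE; ring.
  by apply: (OM) => //; apply: (OM) => //; apply: dI.
have invA : invariant_ideal (A + I).
  by move=> phi; rewrite conjD// invI (conj_principal phi a1).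
have : ideal_class A == 0 by rewrite ideal_class_eq0; apply/asboolP; exists a.
move=> /eqP A0; have := invariant_integral_polya AO invA.
by rewrite ideal_classD A0 add0r.
Qed.

End PolyaInvariant.

(** * Extension of ideals *)

Section ExtensionPolya.
Variables (M : splittingFieldType rat) (K E : {subfield M}) (KE : (K <= E)%VS).
Variables (galK : galois 1 K) (galE : galois 1 E).
Local Notation O := (@ring_of_integers M).
Local Notation ext := (ext_ideal KE).

(** An ideal of [K] is contained in its extension, and O_E meets [K] in O_K; so an
    ideal with trivial extension is integral, and so is its inverse. *)
Lemma ext_ideal_inj : injective ext.
Proof.
have int0 (I : idealGroup K) : ext I = 0 -> integral_idealg I.
  move=> I0 x Ix; have [[IK _ _] _] := idealGroupP I.
  have : O E x.
    rewrite -(ideal_group0E E) -I0 -[x]mulr1; apply: ideal_mul_incl => //.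
    exact: ring_of_integers1.
  by move/ring_of_integersP => [_ ix]; apply/ring_of_integersP; split=> //; apply: IK.
have ext0 (I : idealGroup K) : ext I = 0 -> I = 0.
  move=> I0; apply: val_inj; rewrite eqEsubset; split; first exact: int0.
  by apply/idealg_subP; rewrite sub0r; apply: int0; rewrite raddfN /= I0 oppr0.
by move=> I J IJ; apply/eqP; rewrite -subr_eq0; apply/eqP/ext0; rewrite raddfB /= IJ subrr.
Qed.

Lemma conj_ext phi (I : idealGroup K) :
  conj_ideal phi (ext I) = ext (conj_ideal phi I).
Proof.
apply: val_inj; rewrite /= conjE//= image_ideal_mul image_ring_of_integers.
  by rewrite conjE.
exact: galois_img.
Qed.

Lemma ext_class_polya c : c \in polya K -> ext_class KE c \in polya E.
Proof.
move=> /(polyaP galK)[I invI ->]; rewrite ext_classE; apply/(polyaP galE).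
by exists (ext I) => // phi; rewrite conj_ext invI.
Qed.

Lemma galois_rel : galois K E.
Proof. by apply: galoisS galE; rewrite sub1v. Qed.

(** If [I] is invariant, its power of exponent [E : K] is the product of its
    conjugates over [K], hence extended from an ideal of [K]; this one is invariant
    since extension is injective. *)
Lemma polya_relative_degree c : c \in polya E ->
  exists2 d, d \in polya K & ext_class KE d = c *+ \dim_K E.
Proof.
move=> /(polyaP galE)[I invI ->]; rewrite (galois_dim galois_rel).
have [h [Kh h0 hE]] := norm_idealE I galois_rel galE.
pose J := IdealGroup (asboolT (content_invertible galK Kh h0)).
have JE : ext J = I *+ #|'Gal(E / K)%g|.
  apply: val_inj; rewrite /= -(content_ext _ KE) -hE; congr ideal_set.
  by rewrite -sumr_const; apply: eq_bigr => s _; apply: invI.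
have invJ : invariant_ideal J.
  move=> phi; apply: ext_ideal_inj; rewrite -conj_ext JE -sumr_const conj_sum//.
  by apply: eq_bigr => s _.
exists (ideal_class J); first by apply/(polyaP galK); exists J.
by rewrite ext_classE JE /ideal_class raddfMn.
Qed.

(** If I O_E is generated by [a], the product of its conjugates over [K] is both
    the extension of a power of [I] and generated by the norm of [a]. *)
Lemma ext_class_ker c : ext_class KE c = 0 -> c *+ \dim_K E = 0.
Proof.
rewrite -[c]reprK; set I := generic_quotient.repr c.
rewrite -[X in ext_class KE X]/(ideal_class I) ext_classE.
move=> /eqP; rewrite ideal_class_eq0 => /asboolP[a [Ea a0 IE]].
have Na : galNorm K E a \in K by apply: mem_galNorm => //; apply: galois_rel.
have N0 : galNorm K E a != 0 by rewrite galNorm_eq0.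
pose A := IdealGroup (asboolT (invertible_principal Na N0)).
have extA : ext A = ext (I *+ #|'Gal(E / K)%g|).
  rewrite raddfMn /= -sumr_const.
  have -> : \sum_(s in 'Gal(E / K)%g) ext I =
      \sum_(s in 'Gal(E / K)%g) conj_ideal (gal_repr s) (ext I).
    apply: eq_bigr => s galEs; apply: val_inj.
    rewrite /= conjE//= image_ideal_mul image_ring_of_integers ?limg_gal//.
    congr ideal_mul; apply/esym/eq_image_id => x Ix.
    apply: fixed_gal galEs _ => //; have [[IK _ _] _] := idealGroupP I; exact: IK.
  apply: val_inj; rewrite /= principal_ideal_ext//.
  rewrite /galNorm; apply/esym.
  apply: (big_ind2 (fun (B : idealGroup E) b => ideal_set B = principal_ideal E b)).
  - by rewrite principal_ideal1.
  - by move=> B b C c' BE CE; rewrite ideal_groupDE BE CE principal_ideal_mul.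
  by move=> s _; rewrite conjE// IE image_principal// limg_gal.
have IA := ext_ideal_inj extA; apply/eqP; rewrite (galois_dim galois_rel).
rewrite /ideal_class -raddfMn -/(ideal_class _) ideal_class_eq0 -IA.
by apply/asboolP; exists (galNorm K E a).
Qed.

End ExtensionPolya.

(** An invariant ideal to the power [K : Q] is the product of its conjugates, whose
    content is rational. *)
Lemma polya_degree (M : splittingFieldType rat) (K : {subfield M}) c :
  galois 1 K -> c \in polya K -> c *+ \dim K = 0.
Proof.
move=> galK /(polyaP galK)[I invI ->].
have -> : \dim K = #|'Gal(K / 1)%g| by rewrite -(galois_dim galK) dimv1 divn1.
have [h [h1 h0 hE]] := norm_idealE I galK galK.
have [d [d1 d0 dE]] := content_rational K h1 h0.
apply/eqP; rewrite /ideal_class -raddfMn -/(ideal_class _) ideal_class_eq0.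
apply/asboolP; exists d; split=> //; first exact: (subvP (sub1v K)).
by rewrite -dE -hE -sumr_const; congr ideal_set; apply: eq_bigr => s _; rewrite invI.
Qed.

(** * Splitting of torsion in abelian groups *)

Section Torsion.
Variable V : zmodType.
Implicit Types x : V.

Lemma mulrn_mod x b m : x *+ b = 0 -> x *+ m = x *+ (m %% b).
Proof. by move=> xb; rewrite {1}(divn_eq m b) mulrnDr mulnC mulrnA xb mul0rn add0r. Qed.

Lemma mulrn_eq1_mod x b m : x *+ b = 0 -> m = 1 %[mod b] -> x *+ m = x.
Proof. by move=> xb mb; rewrite (mulrn_mod _ xb) mb -mulrn_mod. Qed.

Lemma mulrn_eq0_mod x b m : x *+ b = 0 -> m = 0 %[mod b] -> x *+ m = 0.
Proof. by move=> xb mb; rewrite (mulrn_mod _ xb) mb mod0n. Qed.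

Lemma coprime_torsion x a b : coprime a b -> x *+ a = 0 -> x *+ b = 0 -> x = 0.
Proof.
move=> ab xa xb; rewrite -(mulrn_eq1_mod (m := chinese a b 0 1) xb).
  by rewrite (mulrn_eq0_mod xa)// chinese_modl.
by rewrite chinese_modr.
Qed.

End Torsion.

Lemma zmod_isomorphic_sym (U V : zmodType) (f : V -> U) :
  zmod_morphism f -> bijective f -> zmod_isomorphic U V.
Proof.
move=> fB [g fK gK].
pose fA : {additive V -> U} := HB.pack f (GRing.isZmodMorphism.Build _ _ f fB).
have gB : zmod_morphism g := can2_zmod_morphism (f := fA) fK gK.
pose gA : {additive U -> V} := HB.pack g (GRing.isZmodMorphism.Build _ _ g gB).
by exists gA; exists f.
Qed.

Section Amalgam.
Variables (P0 P1 P2 PL : zmodType) (n0 n1 n2 : nat).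
Variables (e1 : {additive P0 -> P1}) (e2 : {additive P0 -> P2}).
Variables (f1 : {additive P1 -> PL}) (f2 : {additive P2 -> PL}).
Variables (S1 : zmodClosed P1) (S2 : zmodClosed P2).
Hypotheses (co01 : coprime n0 n1) (co02 : coprime n0 n2) (co12 : coprime n1 n2).
Hypothesis P0_tors : forall x : P0, x *+ n0 = 0.
Hypothesis e1_ker : forall x, e1 x = 0 -> x *+ n1 = 0.
Hypotheses (e1_coker : forall y, exists x, e1 x = y *+ n1)
  (e2_coker : forall z, exists x, e2 x = z *+ n2).
Hypotheses (f1_ker : forall y, f1 y = 0 -> y *+ n2 = 0)
  (f2_ker : forall z, f2 z = 0 -> z *+ n1 = 0).
Hypotheses (f1_coker : forall w, exists y, f1 y = w *+ n2)
  (f2_coker : forall w, exists z, f2 z = w *+ n1).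
Hypothesis comm : forall x, f1 (e1 x) = f2 (e2 x).
Hypotheses (S1P : forall y, y \in S1 <-> exists x, y = e1 x)
  (S2P : forall z, z \in S2 <-> exists x, z = e2 x).

Section Retract.
Variables (P : zmodType) (n : nat) (e : {additive P0 -> P}) (S : zmodClosed P).
Hypotheses (co : coprime n0 n) (coker : forall y, exists x, e x = y *+ n).
Hypothesis SP : forall y, y \in S <-> exists x, y = e x.

(** A section of the projection onto P/S.  The multiplier is 0 modulo [n0] and 1
    modulo [n], so it kills the image of [P0] and acts as the identity on the
    quotient. *)
Definition retract (y : Quotient.quot S) : P :=
  generic_quotient.repr y *+ chinese n0 n 0 1.

Local Notation pi := (\pi_(Quotient.quot S)%qT).

Lemma quot_eq0 y : (pi y == 0) = (y \in S).
Proof.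
have -> : 0 = pi 0 by rewrite raddf0.
by rewrite -Quotient.idealrBE subr0.
Qed.

Lemma retract_pi y : retract (pi y) = y *+ chinese n0 n 0 1.
Proof.
apply/eqP; rewrite /retract -subr_eq0 -mulrnBl.
have : generic_quotient.repr (pi y) - y \in S.
  by rewrite -quot_eq0 raddfB /= reprK subrr.
move=> /SP[x ->]; rewrite -raddfMn (mulrn_eq0_mod (P0_tors x)) ?raddf0//.
by rewrite chinese_modl.
Qed.

Lemma retract_is_zmod_morphism : zmod_morphism retract.
Proof.
move=> y y'; rewrite -[y]reprK -[y']reprK -raddfB !retract_pi.
by rewrite mulrnBl.
Qed.

Lemma quot_tors y : y *+ n \in S.
Proof. by have [x xE] := coker y; apply/SP; exists x. Qed.

Lemma sub_retract y : y - y *+ chinese n0 n 0 1 \in S.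
Proof.
have yn : pi y *+ n = 0.
  by have := quot_tors y; rewrite -quot_eq0 => /eqP <-; rewrite raddfMn.
rewrite -quot_eq0 raddfB /= raddfMn /= (mulrn_eq1_mod yn) ?subrr//.
by rewrite chinese_modr.
Qed.

Lemma retract_tors (y : P) : y *+ chinese n0 n 0 1 *+ n = 0.
Proof.
have [x xE] := coker y; rewrite mulrnAC -xE -raddfMn.
by rewrite (mulrn_eq0_mod (P0_tors x)) ?raddf0// chinese_modl.
Qed.

End Retract.

(** The inverse isomorphism adds the images of the three summands in [PL].  They
    are killed by [n0], [n1] and [n2] respectively, whence injectivity; for
    surjectivity, a Bezout relation between [n1] and [n2] writes each element as a
    sum of images from [P1] and [P2], which split along [P0]. *)
Lemma coprime_amalgam :
  zmod_isomorphic PL (P0 * Quotient.quot S1 * Quotient.quot S2)%type.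
Proof.
pose r1 := @retract P1 n1 S1; pose r2 := @retract P2 n2 S2.
pose psi (t : P0 * Quotient.quot S1 * Quotient.quot S2) : PL :=
  f1 (e1 t.1.1) + f1 (r1 t.1.2) + f2 (r2 t.2).
have psiB : zmod_morphism psi.
  move=> [[x y] z] [[x' y'] z']; rewrite /psi /=.
  rewrite /r1 /r2 !(retract_is_zmod_morphism co01 S1P, retract_is_zmod_morphism co02 S2P).
  by rewrite !raddfB /= !opprD [RHS]addrACA; congr (_ + _); exact: addrACA.
apply: (zmod_isomorphic_sym psiB).
have psi_inj t : psi t = 0 -> t = 0.
  case: t => [[x y] z]; rewrite /psi /= -[y]reprK -[z]reprK.
  set y1 := generic_quotient.repr y; set z1 := generic_quotient.repr z.
  rewrite /r1 /r2 (retract_pi co01 S1P) (retract_pi co02 S2P).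
  set y' := y1 *+ _; set z' := z1 *+ _ => sum0.
  have y'n : y' *+ n1 = 0 := retract_tors co01 e1_coker y1.
  have z'n : z' *+ n2 = 0 := retract_tors co02 e2_coker z1.
  have f1y'n : f1 y' *+ n1 = 0 by rewrite -raddfMn y'n raddf0.
  have f2z'n : f2 z' *+ n2 = 0 by rewrite -raddfMn z'n raddf0.
  have A0 : f1 (e1 x) = 0.
    apply: (@coprime_torsion _ _ n0 (n1 * n2)); first by rewrite coprimeMr co01.
      by rewrite -!raddfMn P0_tors !raddf0.
    have -> : f1 (e1 x) = - (f1 y' + f2 z') by apply/eqP; rewrite -addr_eq0 addrA sum0.
    by rewrite mulNrn mulrnDl mulrnA f1y'n mul0rn add0r mulnC mulrnA f2z'n mul0rn oppr0.
  move: sum0; rewrite A0 add0r => sum0.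
  have B0 : f1 y' = 0.
    apply: (@coprime_torsion _ _ n1 n2) => //.
    have -> : f1 y' = - f2 z' by apply/eqP; rewrite -addr_eq0 sum0.
    by rewrite mulNrn f2z'n oppr0.
  move: sum0; rewrite B0 add0r => C0.
  have ex0 : e1 x = 0.
    apply: (coprime_torsion co02); last exact: f1_ker.
    by rewrite -raddfMn P0_tors raddf0.
  have -> : x = 0 by apply: (coprime_torsion co01); [exact: P0_tors|exact: e1_ker].
  have y'0 : y' = 0 by apply: (coprime_torsion co12) => //; exact: f1_ker.
  have z'0 : z' = 0 by apply: (coprime_torsion co12) => //; exact: f2_ker.
  congr (_, _, _); apply/eqP; rewrite quot_eq0.
    by have := sub_retract co01 e1_coker S1P y1; rewrite -/y' y'0 subr0.
  by have := sub_retract co02 e2_coker S2P z1; rewrite -/z' z'0 subr0.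
have psi_surj w : exists t, psi t = w.
  have [u [v uv]] := Bezoutz n1 n2.
  have [y yE] := f1_coker w; have [z zE] := f2_coker w.
  have /S1P[x xE] := sub_retract co01 e1_coker S1P (y *~ v).
  have /S2P[x' xE'] := sub_retract co02 e2_coker S2P (z *~ u).
  exists (x + x', \pi_(Quotient.quot S1)%qT (y *~ v), \pi_(Quotient.quot S2)%qT (z *~ u)).
  rewrite /psi /= /r1 /r2 (retract_pi co01 S1P) (retract_pi co02 S2P).
  rewrite !raddfD /= (comm x') -xE -xE' !raddfB /=.
  rewrite -addrA addrACA !subrK !raddfMz /= yE zE.
  have gcd1 : gcdz n1 n2 = 1 by move: co12; rewrite /coprime /gcdz /= => /eqP ->.
  rewrite -[RHS]mulr1z -gcd1 -uv mulrzDr addrC.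
  by rewrite [u * _]mulrC [v * _]mulrC !mulrzA.
exists (fun w => sval (cid (psi_surj w))) => [t|w]; last by case: cid.
case: cid => t' /= tt'; apply/eqP; rewrite -subr_eq0; apply/eqP/psi_inj.
by rewrite psiB tt' subrr.
Qed.

End Amalgam.

(** * The composite of two Galois extensions *)

Section Composite.
Variable M : splittingFieldType rat.
Implicit Types K E L : {subfield M}.

Lemma number_field_separable K E : separable K E.
Proof.
apply/separableP => x _; apply: pcharf0_separable => p.
by apply/negP => /andP[p_pr]; rewrite natr_field_eq0 => /eqP p0; rewrite p0 in p_pr.
Qed.

Lemma galoisP K : galois 1 K <-> forall phi : 'AEnd(M), (phi @: K)%VS = K.
Proof.
split=> [galK phi|stab]; first exact: galois_img.
rewrite /galois sub1v number_field_separable /=.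
by apply/forall_inP => phi _; rewrite stab.
Qed.

Lemma galois_cap K E : galois 1 K -> galois 1 E -> galois 1 (K :&: E)%AS.
Proof.
move=> galK galE; apply/galoisP => phi; apply/eqP.
rewrite eqEdim limg_dim_eq ?(eqP (AEnd_lker0 _)) ?capv0// leqnn andbT.
by rewrite subv_cap -[X in _ && (_ <= X)%VS](galois_img phi galE)
  -[X in (_ <= X)%VS && _](galois_img phi galK) !limgS ?capvSl ?capvSr.
Qed.

Lemma galois_prodv K E : galois 1 K -> galois 1 E -> galois 1 (K * E)%AS.
Proof.
move=> galK galE; apply/galoisP => phi.
by rewrite /= aimgM !galois_img.
Qed.

(** A primitive element of [K2] over [K] generates the composite over [K1], and its
    minimal polynomial can only get smaller. *)
Lemma dim_composite_le K K1 K2 L : (K <= K1)%VS -> (K <= K2)%VS ->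
  (L <= K1 * K2)%VS -> (\dim L <= \dim_K K2 * \dim K1)%N.
Proof.
move=> KK1 KK2 LE; pose t := separable_generator K K2.
have K2E : K2 = <<K; t>>%VS :> {vspace _}.
  by apply: eq_adjoin_separable_generator => //; apply: number_field_separable.
have LS : (L <= <<K1; t>>)%VS.
  apply: subv_trans LE _; apply: prodv_sub; first exact: subv_adjoin.
  by rewrite K2E; apply/FadjoinP; rewrite memv_adjoin (subv_trans KK1) ?subv_adjoin.
apply: leq_trans (dimvS LS) _; rewrite dim_Fadjoin leq_mul2r; apply/orP; right.
rewrite K2E -adjoin_degreeE -ltnS -!size_minPoly.
by apply: dvdp_leq (minPolyS _ KK1); rewrite monic_neq0// monic_minPoly.
Qed.

(** Multiplicativity of degrees and coprimality give the reverse inequality. *)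
Lemma dim_composite K1 K2 L : L = (K1 * K2)%VS :> {vspace M} ->
    coprime (\dim_(K1 :&: K2) K1) (\dim_(K1 :&: K2) K2) ->
  \dim_K1 L = \dim_(K1 :&: K2) K2.
Proof.
move=> LE co; pose K0 := (K1 :&: K2)%AS.
have K1L : (K1 <= L)%VS by rewrite LE field_subvMr.
have K2L : (K2 <= L)%VS by rewrite LE field_subvMl.
have K01 : (K0 <= K1)%VS := capvSl K1 K2.
have K02 : (K0 <= K2)%VS := capvSr K1 K2.
have dK1 := dim_sup_field K01; have dK2 := dim_sup_field K02.
have dL1 := dim_sup_field K1L; have dL2 := dim_sup_field K2L.
have LLE : (L <= K1 * K2)%VS by rewrite LE.
have := dim_composite_le K01 K02 LLE.
have K0_gt0 : (0 < \dim K0)%N by apply: adim_gt0.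
have K1_gt0 : (0 < \dim K1)%N by apply: adim_gt0.
rewrite {1}dL1 leq_pmul2r// => le; apply/eqP; rewrite eqn_leq le /=.
apply: dvdn_leq; first by rewrite divn_gt0// dimvS.
rewrite -(Gauss_dvdr _ (_ : coprime _ (\dim_K0 K1))); last by rewrite coprime_sym.
have /eqP : (\dim_K0 K1 * \dim_K1 L * \dim K0 = \dim_K2 L * \dim_K0 K2 * \dim K0)%N.
  by rewrite mulnAC -dK1 mulnC -dL1 -mulnA -dK2.
by rewrite eqn_pmul2r// => /eqP ->; apply: dvdn_mull.
Qed.

Lemma ext_class_comp K E L (KE : (K <= E)%VS) (EL : (E <= L)%VS) (KL : (K <= L)%VS) c :
  ext_class EL (ext_class KE c) = ext_class KL c.
Proof.
rewrite -[c]reprK; set I := generic_quotient.repr c.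
rewrite -[X in ext_class KE X]/(ideal_class I) -[X in ext_class KL X]/(ideal_class I).
rewrite !ext_classE; congr ideal_class; apply: val_inj => /=.
by rewrite -ideal_mulA ideal_mul_extO.
Qed.

Section PolyaHom.
Variables (K E : {subfield M}) (KE : (K <= E)%VS).
Variables (galK : galois 1 K) (galE : galois 1 E).

Definition polya_hom (c : polyaGroup K) : polyaGroup E :=
  exist _ (ext_class KE (val c)) (ext_class_polya KE galK galE (valP c)).

Fact polya_hom_is_zmod_morphism : zmod_morphism polya_hom.
Proof. by move=> c d; apply: val_inj; rewrite /= !raddfB. Qed.

HB.instance Definition _ := GRing.isZmodMorphism.Build _ _ polya_hom
  polya_hom_is_zmod_morphism.

Lemma polya_hom_ker c : polya_hom c = 0 -> c *+ \dim_K E = 0.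
Proof.
move=> /(congr1 val) c0; apply: val_inj; rewrite raddfMn raddf0.
exact: (ext_class_ker galE c0).
Qed.

Lemma polya_hom_coker c : exists d, polya_hom d = c *+ \dim_K E.
Proof.
have [d dP dE] := polya_relative_degree KE galK galE (valP c).
by exists (exist _ d dP); apply: val_inj; rewrite raddfMn.
Qed.

Lemma ext_polyaP c : c \in ext_polya KE <-> exists d, c = polya_hom d.
Proof.
split=> [/asboolP[d dP dE]|[d ->]].
  by exists (exist _ d dP); apply: val_inj.
by apply/asboolP; exists (val d) => //; apply: valP.
Qed.

End PolyaHom.

End Composite.

Theorem theorem3p11 (M : splittingFieldType rat) (K1 K2 : {subfield M})
  (galK1 : galois 1 K1) (galK2 : galois 1 K2)
  (co12 : coprime (\dim_(K1 :&: K2) K1) (\dim_(K1 :&: K2) K2))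
  (co10 : coprime (\dim_(K1 :&: K2) K1) (\dim (K1 :&: K2)))
  (co20 : coprime (\dim_(K1 :&: K2) K2) (\dim (K1 :&: K2))) :
  zmod_isomorphic
    (polyaGroup (K1 * K2)%AS)
    (polyaGroup (K1 :&: K2)%AS * relPolyaGroup (capvSl K1 K2)
                               * relPolyaGroup (capvSr K1 K2))%type.
Proof.
have galK0 := galois_cap galK1 galK2; have galL := galois_prodv galK1 galK2.
have K1L : (K1 <= (K1 * K2)%AS)%VS := field_subvMr K1 K2.
have K2L : (K2 <= (K1 * K2)%AS)%VS := field_subvMl K1 K2.
have d1 : \dim_K1 (K1 * K2)%AS = \dim_(K1 :&: K2) K2 by apply: dim_composite.
have d2 : \dim_K2 (K1 * K2)%AS = \dim_(K1 :&: K2) K1.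
  rewrite capvC; apply: dim_composite; first by rewrite /= prodvC.
  by rewrite capvC coprime_sym.
apply: (@coprime_amalgam _ _ _ _ (\dim (K1 :&: K2)) (\dim_(K1 :&: K2) K1)
  (\dim_(K1 :&: K2) K2) (polya_hom (capvSl K1 K2) galK0 galK1)
  (polya_hom (capvSr K1 K2) galK0 galK2) (polya_hom K1L galK1 galL)
  (polya_hom K2L galK2 galL)).
- by rewrite coprime_sym.
- by rewrite coprime_sym.
- exact: co12.
- move=> c; apply: val_inj; rewrite raddfMn raddf0.
  exact: (polya_degree galK0 (valP c)).
- exact: polya_hom_ker.
- exact: polya_hom_coker.
- exact: polya_hom_coker.
- by rewrite -d1; apply: polya_hom_ker.
- by rewrite -d2; apply: polya_hom_ker.
- by rewrite -d1; apply: polya_hom_coker.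
- by rewrite -d2; apply: polya_hom_coker.
- move=> c; apply: val_inj => /=.
  have K0L : ((K1 :&: K2)%AS <= (K1 * K2)%AS)%VS := subv_trans (capvSl K1 K2) K1L.
  by rewrite !(ext_class_comp _ _ K0L).
- exact: ext_polyaP.
- exact: ext_polyaP.
Qed.
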